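(* Let $K$ be a triangulation of the sphere $S^{d-1}$ on $N+1$ vertices, regarded as a subcomplex of the simplex $\Delta_N$ on the same vertex set. Then $\chi(\mathrm{KG}^2(K,\Delta_N))=N+1-d$.
   Context: $\Delta_N$ denotes the $N$-dimensional simplex, i.e. the simplicial complex of all subsets of an $(N+1)$-element vertex set. For a simplicial complex $L$ and subcomplex $K\subseteq L$, $\mathrm{KG}^2(K,L)$ is the graph whose vertices are the inclusion-minimal faces of $L$ that are not faces of $K$ (the missing faces of $K$ when $L=\Delta_N$), with an edge between two vertices exactly when the corresponding faces are disjoint. $\chi$ denotes the chromatic number. *)

(* Defs.v *)
From HB Require Import structures.
From mathcomp Require Import all_boot all_order all_algebra.

Set Implicit Arguments.
Unset Strict Implicit.
Unset Printing Implicit Defensive.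

Import Order.TTheory GRing.Theory Num.Theory.
Local Open Scope ring_scope.

Record sgraph := SGraph {
  vertex :> finType;
  adj : rel vertex;
  adj_sym : symmetric adj;
  adj_irr : irreflexive adj }.

Definition colorable (G : sgraph) (k : nat) : bool :=
  [exists c : {ffun G -> 'I_k},
    [forall x, forall y, adj x y ==> (c x != c y)]].

Lemma colorable_card (G : sgraph) : exists k, colorable G k.
Proof.
exists #|G|; apply/existsP; exists [ffun x => enum_rank x].
apply/forallP => x; apply/forallP => y; apply/implyP => xy.
rewrite !ffunE; apply/negP => /eqP /enum_rank_inj exy.
by move: xy; rewrite exy adj_irr.
Qed.

Definition chromatic_number (G : sgraph) : nat := ex_minn (colorable_card G).

(* The empty face always belongs to a complex.  Elements of [T] need not be
   vertices of the complex, see [spanning]. *)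
Record scomplex (T : finType) := SComplex {
  faces :> {set {set T}};
  set0_face : set0 \in faces;
  sub_face : forall A B : {set T}, A \subset B -> B \in faces -> A \in faces }.

Definition spanning (T : finType) (K : scomplex T) : Prop :=
  forall v : T, [set v] \in faces K.

Lemma simplex_set0 (T : finType) : set0 \in [set: {set T}].
Proof. exact: in_setT. Qed.

Lemma simplex_sub (T : finType) (A B : {set T}) :
  A \subset B -> B \in [set: {set T}] -> A \in [set: {set T}].
Proof. by rewrite !in_setT. Qed.

Definition simplex (N : nat) : scomplex 'I_N.+1 :=
  SComplex (@simplex_set0 'I_N.+1) (@simplex_sub 'I_N.+1).

Definition min_nonface (T : finType) (K L : scomplex T) : {set {set T}} :=
  [set A | minset (fun B => (B \in faces L) && (B \notin faces K)) A].

Section KneserGraph.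
Variables (T : finType) (K L : scomplex T).

Definition KG2_vertex : finType := {A : {set T} | A \in min_nonface K L}.

Definition KG2_adj : rel KG2_vertex :=
  fun A B => [disjoint (val A) & (val B)].

Lemma KG2_adj_sym : symmetric KG2_adj.
Proof. by move=> A B; rewrite /KG2_adj disjoint_sym. Qed.

Lemma KG2_adj_irr : irreflexive KG2_adj.
Proof.
move=> [A hA]; apply/negbTE/negP; rewrite /KG2_adj /= -setI_eq0 setIid => /eqP A0.
move: hA; rewrite inE => /minsetp /andP[_].
by rewrite A0 set0_face.
Qed.

Definition KG2 : sgraph := SGraph KG2_adj_sym KG2_adj_irr.

End KneserGraph.

From mathcomp Require Import boolp classical_sets reals topology normedtype.
Import numFieldNormedType.Exports.
Local Open Scope classical_set_scope.

(* Barycentric coordinates: points of the standard simplex whose support is a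
   face of [K]. *)
Definition realization (R : realType) (n : nat) (K : scomplex 'I_n) :
    set 'rV[R]_n :=
  [set x : 'rV[R]_n | [/\ forall i, 0 <= x ord0 i, \sum_i x ord0 i = 1 &
     [set i | x ord0 i != 0]%SET \in faces K]].

(* The unit sphere of the Euclidean space R^d, of dimension d - 1; it is empty
   for d = 0.  The norm that the library puts on row vectors is the sup norm, so
   the Euclidean one is spelled out. *)
Definition sphere (R : realType) (d : nat) : set 'rV[R]_d :=
  [set x : 'rV[R]_d | \sum_i x ord0 i ^+ 2 = 1].

(* [A] and [B], with their subspace topologies, are homeomorphic; the values of
   [f] outside [A] and of [g] outside [B] are irrelevant. *)
Definition homeomorphic (X Y : topologicalType) (A : set X) (B : set Y) :
    Prop :=
  exists (f : X -> Y) (g : Y -> X),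
    [/\ {within A, continuous f}, {within B, continuous g},
        forall x, A x -> B (f x) /\ g (f x) = x &
        forall y, B y -> A (g y) /\ f (g y) = y].

Definition triangulates_sphere (R : realType) (d n : nat)
    (K : scomplex 'I_n) : Prop :=
  homeomorphic (@realization R n K) (@sphere R d).

(* Main.v *)
Require Import Defs.
From mathcomp Require Import all_boot all_order all_algebra.
From mathcomp Require Import boolp classical_sets reals topology normedtype.
From mathcomp Require Import sequences ring lra zify.

(** The lower bound is a Borsuk-Ulam argument.  A sphere of dimension [d - 1] in
    R^d gives a map [(s x, t y) |-> s f(x) - t f(y)] without zeros on the
    deleted join of [K]; together with a colouring by [m] colours it labels the
    points of the cross-polytope boundary in R^(N+1) antipodally by [m + d]
    pairs of opposite labels, with no opposite labels on close points, so
    [N + 1 <= m + d] by Fan's lemma.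

    Fan's lemma is proved on chains mod 2, for the barycentric subdivisions of
    the cross-polytope: if [alt] counts the simplices whose labels, sorted by
    absolute value, alternate in sign starting with [+], then the coboundary of
    [alt] is [alt] plus its antipode, so the values of [alt] on the spheres of
    consecutive dimensions agree.

    For the upper bound, if [F] is a face with [d] vertices then every missing
    face has a vertex outside [F], which can be taken as its colour.  Such a
    face exists because otherwise points of [K], hence of the sphere, could be
    moved slightly so that close points take at most [d - 1] values; Fan's lemma
    on a hemisphere, with labels read off the moved points away from the
    equator, forbids this. *)

Set Implicit Arguments.
Unset Strict Implicit.
Unset Printing Implicit Defensive.

Import Order.TTheory GRing.Theory Num.Theory.
Import numFieldNormedType.Exports.
Local Open Scope classical_set_scope.
Local Open Scope ring_scope.

(** * Chains mod 2 *)

Fixpoint alternating (b : bool) (s : seq bool) : bool :=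
  if s is x :: s' then (x == b) && alternating (~~ b) s' else true.

(* Chains mod 2 are lists of simplices, compared only through the parities of
   all their evaluations; simplices are lists of vertices, and the complex is
   augmented: the boundary of a vertex is the empty simplex. *)
Definition parity (T : Type) (a : seq T -> bool) (C : seq (seq T)) : bool :=
  \big[addb/false]_(s <- C) a s.

Lemma parity_map (T U : Type) (a : seq U -> bool) (h : seq T -> seq U) C :
  parity a (map h C) = parity (a \o h) C.
Proof. exact: big_map. Qed.

Section Chains.
Variable T : eqType.
Implicit Types (s : seq T) (C : seq (seq T)).

Fixpoint boundary s : seq (seq T) :=
  if s is x :: s' then s' :: map (cons x) (boundary s') else [::].

Definition cboundary C := flatten (map boundary C).

Lemma parity_cat a C1 C2 : parity a (C1 ++ C2) = parity a C1 (+) parity a C2.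
Proof. exact: big_cat. Qed.

Lemma parity_cons a s C : parity a (s :: C) = a s (+) parity a C.
Proof. exact: big_cons. Qed.

Lemma parity_flatten a (h : seq T -> seq (seq T)) C :
  parity a (flatten (map h C)) = parity (fun s => parity a (h s)) C.
Proof.
elim: C => [|s C IH]; first by rewrite /parity !big_nil.
by rewrite /= parity_cat IH parity_cons.
Qed.

Lemma parity_addb a1 a2 C :
  parity (fun s => a1 s (+) a2 s) C = parity a1 C (+) parity a2 C.
Proof. exact: big_split. Qed.

Lemma parity_nil (a : seq T -> bool) : parity a [::] = false.
Proof. exact: big_nil. Qed.

Lemma parity0 C : parity (fun _ : seq T => false) C = false.
Proof. by rewrite /parity big1. Qed.

Lemma eq_parity a1 a2 C : a1 =1 a2 -> parity a1 C = parity a2 C.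
Proof. by move=> e; apply: eq_bigr => s _; apply: e. Qed.

Lemma parity_boundary_cons a x s :
  parity a (boundary (x :: s)) = a s (+) parity (a \o cons x) (boundary s).
Proof. by rewrite /= parity_cons parity_map. Qed.

Lemma parity_cboundary a C :
  parity a (cboundary C) = parity (fun s => parity a (boundary s)) C.
Proof. exact: parity_flatten. Qed.

Lemma boundaryK a s : parity a (cboundary (boundary s)) = false.
Proof.
rewrite parity_cboundary; elim: s a => [|x s IH] a; first by rewrite parity_nil.
rewrite parity_boundary_cons (@eq_parity (_ \o _)
  (fun t => a t (+) parity (a \o cons x) (boundary t))); last first.
  by move=> t; rewrite -parity_boundary_cons.
by rewrite parity_addb IH addbF addbb.
Qed.

Lemma size_boundary s t : t \in boundary s -> (size t).+1 = size s.
Proof.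
elim: s t => [|x s IH] t //=; rewrite inE => /predU1P[-> //|/mapP[u /IH <- ->]] //.
Qed.

Lemma sub_boundary s t : t \in boundary s -> {subset t <= s}.
Proof.
elim: s t => [|x s IH] t //=; rewrite inE => /predU1P[->|/mapP[u /IH us ->]] y.
  by rewrite inE orbC => ->.
by rewrite !inE => /predU1P[->|/us ->]; rewrite ?eqxx ?orbT.
Qed.

Lemma eq_in_parity a1 a2 C : {in C, a1 =1 a2} -> parity a1 C = parity a2 C.
Proof. by move=> e; rewrite /parity !big_seq; apply: eq_bigr => s; apply: e. Qed.

End Chains.

Lemma boundary_map (T U : eqType) (f : T -> U) s :
  boundary (map f s) = map (map f) (boundary s).
Proof. by elim: s => [|x s IH] //=; rewrite IH -!map_comp. Qed.

Lemma boundary_subseq (T : eqType) (s t : seq T) :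
  t \in boundary s -> subseq t s.
Proof.
elim: s t => [|x s IH] t //=; rewrite inE => /predU1P[->|/mapP[u /IH us ->]].
  exact: subseq_cons.
by rewrite /= eqxx.
Qed.

(** Induction on the list. If the first sign is not [b], only the face omitting it can alternate
    from [b]; if it is [b], the faces keeping it reduce to the tail with the other sign. *)
Lemma parity_alternating b s :
  parity (alternating b) (boundary s) = alternating b s (+) alternating (~~ b) s.
Proof.
elim: s b => [|x s IH] b; first by rewrite parity_nil.
rewrite parity_boundary_cons /= negbK.
have [->|/negbTE xb] := eqVneq x b.
  rewrite (@eq_parity _ _ (alternating (~~ b))); last by move=> t /=; rewrite eqxx.
  rewrite IH negbK; case: (b) => /=; by rewrite addbCA addbb !addbF.
rewrite (@eq_parity _ _ (fun=> false)); last by move=> t /=; rewrite xb.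
by rewrite parity0 addbF; move: xb; case: x; case: (b).
Qed.

(** Labels are sorted before alternation is read off, while faces come from ordered lists. For
    symmetric [a], deleting by position or by value with [rem] gives the same sum, and the latter
    form is invariant under permutation. *)
Lemma parity_perm_boundary (T : eqType) (a : seq T -> bool) :
  (forall s t, perm_eq s t -> a s = a t) ->
  forall s t, perm_eq s t -> parity a (boundary s) = parity a (boundary t).
Proof.
move=> ha.
suff E s : parity a (boundary s) = \big[addb/false]_(x <- s) a (rem x s).
  move=> s t st; rewrite !E (perm_big _ st) /=; apply: eq_bigr => x _.
  by apply/ha/permP => p; rewrite !count_rem (permP st) (perm_mem st).
elim: s a ha => [|x s IH] a ha; first by rewrite parity_nil big_nil.
rewrite parity_boundary_cons big_cons /= eqxx IH; last first.
  by move=> u v uv /=; apply: ha; rewrite perm_cons.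
congr (_ (+) _); rewrite !big_seq; apply: eq_bigr => y ys /=.
case: eqP => [xy|//]; apply: ha; rewrite -xy in ys *.
by rewrite perm_sym perm_to_rem.
Qed.

(** * Barycentric subdivision *)

Section Subdivision.
Variables (R : realType) (m : nat).
Let V := 'rV[R]_m.
Implicit Types (s t : seq V) (C : seq (seq V)) (D : R).

Definition barycenter s : V := (size s)%:R^-1 *: \sum_(x <- s) x.

(** Cones from the barycenter over the subdivided facets. The number [n] is fuel, since facets are
    not structural subterms; [subdiv] supplies the number of vertices. *)
Fixpoint subdiv_rec n s : seq (seq V) :=
  if n is n'.+1 then
    map (cons (barycenter s)) (flatten (map (subdiv_rec n') (boundary s)))
  else [:: s].

Definition subdiv s := subdiv_rec (size s) s.

Definition csubdiv C := flatten (map subdiv C).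

(** The boundary of a cone is its base plus the cone over the boundary of the base. By induction the
    latter is a cone over the subdivided boundary of a boundary, hence vanishes. *)
Lemma boundary_subdiv a s :
  parity a (cboundary (subdiv s)) = parity a (csubdiv (boundary s)).
Proof.
rewrite /subdiv; have [n sn] : exists n, n = size s by exists (size s).
rewrite -sn; elim: n s sn a => [|n IH] s sn a.
  by case: s sn => // _; rewrite /cboundary /= parity_nil.
have eqb : csubdiv (boundary s) = flatten (map (subdiv_rec n) (boundary s)).
  congr flatten; apply/eq_in_map => t /size_boundary; rewrite -sn => -[<-] //.
rewrite eqb /= parity_cboundary parity_map.
rewrite (@eq_parity _ _ (fun t => a t (+) parity (a \o cons (barycenter s))
   (boundary t))); last by move=> t; rewrite -parity_boundary_cons.
rewrite parity_addb [X in _ (+) X](_ : _ = false) ?addbF //.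
rewrite parity_flatten; set b := a \o _.
case: n IH sn eqb => [|n] IH sn eqb.
  case: s sn @b eqb => [|x [|y s]] // _ b _ /=.
  by rewrite /parity !big_cons !big_nil.
rewrite (@eq_in_parity _ _ (fun t => parity b (flatten (map (subdiv_rec n) (boundary t))))).
  by rewrite -[RHS](boundaryK (fun t => parity b (subdiv_rec n t)) s)
       parity_cboundary; apply: eq_parity => t; rewrite parity_flatten.
move=> t ts; have /eqP := size_boundary ts; rewrite -sn eqSS => /eqP tn.
rewrite -parity_cboundary IH // /csubdiv; congr (parity _ (flatten _)).
by apply/eq_in_map => u /size_boundary; rewrite tn => -[<-].
Qed.

Lemma barycenterN s : barycenter (map -%R s) = - barycenter s.
Proof.
rewrite /barycenter size_map big_map -scalerN; congr (_ *: _).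
by rewrite sumrN.
Qed.

Lemma subdivN s : subdiv (map -%R s) = map (map -%R) (subdiv s).
Proof.
rewrite /subdiv size_map; move: (size s) => k; elim: k s => [|k IH] s //=.
rewrite barycenterN boundary_map -map_comp.
have -> : flatten (map (subdiv_rec k \o map -%R) (boundary s)) =
    map (map -%R) (flatten (map (subdiv_rec k) (boundary s))).
  by rewrite map_flatten -map_comp; congr flatten; apply: eq_map => t /=.
by rewrite -!map_comp.
Qed.

Lemma mem_subdiv n s t : size s = n.+1 -> t \in subdiv s ->
  exists2 u, u \in boundary s & exists2 v, v \in subdiv u & t = barycenter s :: v.
Proof.
move=> sn; rewrite /subdiv sn /= => /mapP[v /flatten_mapP[u us vu] ->].
by exists u => //; exists v => //; have := size_boundary us; rewrite sn => -[->].
Qed.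

Lemma size_subdiv s t : t \in subdiv s -> size t = size s.
Proof.
have [n] := ubnP (size s); elim: n s t => [|n IH] // s t sn.
case: (posnP (size s)) => [s0|]; first by rewrite /subdiv s0 inE => /eqP ->.
move=> s0 /(mem_subdiv (esym (prednK s0)))[u us [v vu ->]] /=.
by rewrite (IH _ _ _ vu) (size_boundary us).
Qed.

(** Closure under barycenters is the only form of convexity needed: it carries orthants and
    closeness to a fixed point over to subdivisions. *)
Lemma subdiv_convex (P : pred V) s :
  (forall u, u != [::] -> all P u -> P (barycenter u)) ->
  all P s -> {in subdiv s, forall t, all P t}.
Proof.
move=> hP; have [n] := ubnP (size s); elim: n s => [|n IH] // s sn Ps t.
case: (posnP (size s)) => [s0|]; first by rewrite /subdiv s0 inE => /eqP ->.
move=> s0 /(mem_subdiv (esym (prednK s0)))[u us [v vu ->]] /=.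
rewrite hP //=; last by case: s s0 {sn us Ps} => //.
apply: (IH u) => //; first by rewrite -ltnS (size_boundary us).
by apply/allP => x /(sub_boundary us); apply/allP.
Qed.

Definition close D (x y : V) := [forall i, `|x ord0 i - y ord0 i| <= D].

Definition diam_le D s := all2rel (close D) s.

Lemma close_sym D x y : close D x y = close D y x.
Proof. by apply: eq_forallb => i; rewrite distrC. Qed.

Lemma close_le D D' x y : D <= D' -> close D x y -> close D' x y.
Proof. by move=> DD' /forallP xy; apply/forallP => i; apply: le_trans (xy i) _. Qed.

Lemma close_refl D x : 0 <= D -> close D x x.
Proof. by move=> D0; apply/forallP => i; rewrite subrr normr0. Qed.

Lemma barycenter_coord s i :
  barycenter s ord0 i = (size s)%:R^-1 * \sum_(x <- s) x ord0 i.
Proof. by rewrite mxE summxE. Qed.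

Lemma close_convex D x s : s != [::] -> all (close D x) s ->
  close D x (barycenter s).
Proof.
move=> s0 xs; apply/forallP => i; rewrite barycenter_coord.
have n0 : (0 : R) < (size s)%:R by rewrite ltr0n lt0n size_eq0.
rewrite -(ler_pM2l n0) -{1}(ger0_norm (ltW n0)) -normrM mulrBr mulVKf ?gt_eqF //.
have -> : (size s)%:R * x ord0 i - \sum_(y <- s) y ord0 i
   = \sum_(y <- s) (x ord0 i - y ord0 i).
  by rewrite sumrB big_const_seq count_predT iter_addr_0 mulr_natl.
rewrite (le_trans (ler_norm_sum _ _ _)) //.
rewrite mulr_natl -iter_addr_0 -(count_predT s) -big_const_seq !big_seq.
by apply: ler_sum => y ys; have /allP/(_ _ ys)/forallP := xs.
Qed.

(** In the sum of differences the term of [x] itself is zero, so only [size s - 1] terms remain,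
    each at most [D]. *)
Lemma barycenter_close D s x : 0 <= D -> x \in s -> diam_le D s ->
  close ((1 - (size s)%:R^-1) * D) (barycenter s) x.
Proof.
move=> D0 xs /allrelP sD; rewrite close_sym.
have n0 : (0 : R) < (size s)%:R by rewrite ltr0n; case: s xs {sD}.
apply/forallP => i; rewrite barycenter_coord.
rewrite -(ler_pM2l n0) -{1}(ger0_norm (ltW n0)) -normrM mulrBr mulVKf ?gt_eqF //.
have -> : (size s)%:R * x ord0 i - \sum_(y <- s) y ord0 i
   = \sum_(y <- s) (x ord0 i - y ord0 i).
  by rewrite sumrB big_const_seq count_predT iter_addr_0 mulr_natl.
rewrite (le_trans (ler_norm_sum _ _ _)) //.
rewrite (perm_big _ (perm_to_rem xs)) /= big_cons subrr normr0 add0r.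
have -> : (size s)%:R * ((1 - (size s)%:R^-1) * D) = (size (rem x s))%:R * D.
  rewrite size_rem // mulrA mulrBr mulr1 mulfV ?gt_eqF // -subn1 natrB //.
  by rewrite -(ltr0n R).
rewrite mulr_natl -iter_addr_0 -(count_predT (rem x s)) -big_const_seq !big_seq.
by apply: ler_sum => y /mem_rem ys; have /forallP := sD _ _ xs ys.
Qed.

(** A pair of new vertices either involves the barycenter of [s], where convexity extends
    [barycenter_close] to the subdivided facet, or lies in that facet, where induction applies. *)
Lemma diam_subdiv k D s t : 0 <= D -> (size s <= k.+1)%N -> diam_le D s ->
  t \in subdiv s -> diam_le ((1 - k.+1%:R^-1) * D) t.
Proof.
move=> D0; have [n] := ubnP (size s); elim: n s t => [|n IH] // s t sn sk sD.
case: (posnP (size s)) => [s0|]; first by case: s s0 {sD sn sk} => //; rewrite inE => _ /eqP ->.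
move=> s0 /(mem_subdiv (esym (prednK s0)))[u us [v vu ->]] /=.
have D'0 : 0 <= (1 - k.+1%:R^-1) * D.
  by rewrite mulr_ge0 // subr_ge0 invf_le1 ?ler1n ?ltr0n.
have vD : diam_le ((1 - k.+1%:R^-1) * D) v.
  apply: (IH u) => //; [by rewrite -ltnS (size_boundary us)
    |by rewrite -ltnS (size_boundary us) ltnW|].
  by apply/allrelP => x y /(sub_boundary us) xs /(sub_boundary us) ys;
    move/allrelP: sD; apply.
have bv y : y \in v -> close ((1 - k.+1%:R^-1) * D) (barycenter s) y.
  suff /allP h : all (close ((1 - k.+1%:R^-1) * D) (barycenter s)) v by apply: h.
  apply: (subdiv_convex _ _ vu) => [w|]; first exact: close_convex.
  apply/allP => x /(sub_boundary us) xs.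
  apply: close_le (barycenter_close D0 xs sD).
  by rewrite ler_wpM2r // lerD2l lerN2 lef_pV2 ?posrE ?ltr0n ?ler_nat.
apply/allrelP => x y; rewrite !inE => /predU1P[->|xv] /predU1P[->|yv].
- exact: close_refl.
- exact: bv.
- by rewrite close_sym; apply: bv.
- by move/allrelP: vD; apply.
Qed.

End Subdivision.

(** * Fan's lemma on a hemisphere of the cross-polytope *)

(* The label [+j] or [-j] is coded as [2 j + 1] or [2 j]. *)
Definition flip l := if odd l then l.-1 else l.+1.

Lemma odd_flip l : odd (flip l) = ~~ odd l.
Proof. by rewrite /flip; case: l => [|l] //=; case E: (odd l); rewrite /= E. Qed.

Lemma half_flip l : (flip l)./2 = l./2.
Proof.
rewrite /flip; case: ifP => ol; move: (odd_double_half l); rewrite ol.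
  by move=> <-; rewrite add1n /= doubleK uphalf_double.
by move=> <-; rewrite add0n /= uphalf_double doubleK.
Qed.

Lemma half_odd_inj k l : k./2 = l./2 -> odd k = odd l -> k = l.
Proof. by move=> h o; rewrite -(odd_double_half k) h o odd_double_half. Qed.

Lemma half_eq_flip k l : k./2 = l./2 -> k != flip l -> k = l.
Proof.
move=> h kl; apply: half_odd_inj => //; apply/eqP; apply: contraNT kl => o.
apply/eqP/half_odd_inj; rewrite ?half_flip ?odd_flip //.
by case: (odd k) (odd l) o => [] [].
Qed.

(** [flip] exchanges [2 j] and [2 j + 1]; these are the only pairs whose order it reverses. *)
Lemma leq_flip k l : k != flip l -> (flip k <= flip l)%N = (k <= l)%N.
Proof.
move=> kl; have [h|] := eqVneq k./2 l./2; first by rewrite (half_eq_flip h kl) !leqnn.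
move=> h; have eq_half i j : i./2 != j./2 -> (i <= j)%N = (i./2 <= j./2)%N by lia.
by rewrite (eq_half k l) // eq_half !half_flip.
Qed.

Definition alternates b (L : seq nat) := alternating b (map odd (sort leq L)).

Lemma alternates_perm b L L' : perm_eq L L' -> alternates b L = alternates b L'.
Proof.
by move=> LL'; rewrite /alternates (perm_sortP leq_total leq_trans anti_leq _ _ LL').
Qed.

Lemma parity_alternates b L :
  parity (alternates b) (boundary L) = alternates b L (+) alternates (~~ b) L.
Proof.
have := parity_perm_boundary (@alternates_perm b).
move=> /(_ L (sort leq L)) ->; last by rewrite perm_sym perm_sort.
rewrite -parity_alternating boundary_map parity_map.
apply: eq_in_parity => t /boundary_subseq tL /=; rewrite /alternates sorted_sort //.
  exact: leq_trans.
exact: (subseq_sorted leq_trans tL) (sort_sorted leq_total L).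
Qed.

Lemma alternating_negb b s : alternating b (map negb s) = alternating (~~ b) s.
Proof.
elim: s b => [|x s IH] b //=; rewrite IH; congr (_ && _).
by case: x; case: b.
Qed.

Lemma alternates_flip b L : {in L &, forall k l, k != flip l} ->
  alternates b (map flip L) = alternates (~~ b) L.
Proof.
move=> nc; rewrite /alternates.
have -> : sort leq (map flip L) = map flip (sort leq L).
  apply: (sorted_eq leq_trans anti_leq (sort_sorted leq_total _)).
    apply: homo_sorted_in (sort_sorted leq_total L); last first.
      by apply/allP => k; rewrite mem_sort => kL; exact: kL.
    by move=> k l kL lL /=; rewrite leq_flip // nc.
  by rewrite perm_sort perm_map // perm_sym perm_sort.
rewrite -alternating_negb -!map_comp; congr alternating.
by apply: eq_map => l /=; rewrite odd_flip.
Qed.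

(** Neighbours with the same half would be equal, opposite labels being excluded; they would then
    have the same sign, against alternation. *)
Lemma sorted_half b L : {in L &, forall k l, k != flip l} ->
  sorted leq L -> alternating b (map odd L) -> sorted ltn (map half L).
Proof.
elim: L b => [|k [|l L] IH] b nc //.
move=> /andP[kl lL] /= /andP[/eqP kb /andP[/eqP lb al]].
apply/andP; split; last first.
  apply: (IH (~~ b)) => //=; last by rewrite lb eqxx.
  by move=> i j iL jL; apply: nc; rewrite inE ?iL ?jL orbT.
rewrite ltn_neqAle half_leq // andbT; apply/eqP => h.
have := half_eq_flip h (nc _ _ (mem_head _ _) _); rewrite !inE eqxx orbT => /(_ isT) E.
by move: lb; rewrite -E kb; case: (b).
Qed.

Lemma alternates_uniq b L : {in L &, forall k l, k != flip l} ->
  alternates b L -> uniq (map half L).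
Proof.
move=> nc al; have pL : perm_eq L (sort leq L) by rewrite perm_sym perm_sort.
rewrite (perm_uniq (perm_map half pL)).
apply: (sorted_uniq ltn_trans ltnn); apply: sorted_half al; last exact: sort_sorted leq_total _.
by move=> k l; rewrite -!(perm_mem pL); apply: nc.
Qed.

(** * Spheres and hemispheres of the cross-polytope as chains *)

Section Fan.
Variables (R : realType) (n : nat).
Let V := 'rV[R]_n.+1.
Implicit Types (s t : seq V) (C : seq (seq V)) (x y : V).

Definition l1norm (m : nat) (x : 'rV[R]_m) : R := \sum_i `|x ord0 i|.

Definition axis k : V := delta_mx ord0 (inord k).

(** Facets of the cross-polytope on the axes [0] to [k - 1]: the cone over the equator from the new
    apex, and its antipode. [cross 0] consists of the empty simplex, a sphere of dimension -1. *)
Fixpoint cross k : seq (seq V) :=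
  if k is k'.+1 then
    let h := map (cons (axis k')) (cross k') in h ++ map (map -%R) h
  else [:: [::]].

Definition hemisphere k := map (cons (axis k)) (cross k).

Lemma crossS k : cross k.+1 = hemisphere k ++ map (map -%R) (hemisphere k).
Proof. by []. Qed.

Lemma mapNK s : map -%R (map -%R s) = s.
Proof. by rewrite -map_comp map_id_in // => x _ /=; rewrite opprK. Qed.

Lemma parity_crossN a k : parity a (map (map -%R) (cross k)) = parity a (cross k).
Proof.
case: k => [|k] //=; rewrite map_cat !parity_cat addbC; congr (_ (+) _).
by rewrite -(map_comp (map _) (map _)) (eq_map mapNK) map_id.
Qed.

Lemma boundary_hemisphere k :
  (forall a, parity a (cboundary (cross k)) = false) ->
  forall a, parity a (cboundary (hemisphere k)) = parity a (cross k).
Proof.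
move=> h a; rewrite parity_cboundary parity_map.
rewrite (@eq_parity _ (_ \o _) (fun s => a s (+) parity (a \o cons (axis k)) (boundary s))).
  by rewrite parity_addb -(parity_cboundary (a \o _)) h addbF.
by move=> s; rewrite -parity_boundary_cons.
Qed.

(** Both hemispheres have the equator as boundary, since the equator is its own antipode; mod 2 the
    two copies cancel. *)
Lemma boundary_cross k a : parity a (cboundary (cross k)) = false.
Proof.
elim: k a => [|k IH] a; first by rewrite /= parity_nil.
rewrite parity_cboundary crossS parity_cat (parity_map _ _ (hemisphere k)).
rewrite -(parity_cboundary a (hemisphere k)) boundary_hemisphere //.
rewrite (@eq_parity _ ((fun s => parity a (boundary s)) \o map -%R)
  (fun s => parity (a \o map -%R) (boundary s))); last first.
  by move=> s /=; rewrite boundary_map parity_map.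
rewrite -(parity_cboundary (a \o map -%R) (hemisphere k)) boundary_hemisphere //.
by rewrite -(parity_map a (map -%R) (cross k)) parity_crossN addbb.
Qed.

Lemma csubdivN C : csubdiv (map (map -%R) C) = map (map -%R) (csubdiv C).
Proof.
rewrite /csubdiv map_flatten -!map_comp; congr flatten.
by apply: eq_map => s /=; rewrite subdivN.
Qed.

Lemma parity_csubdiv a C : parity a (csubdiv C) = parity (fun s => parity a (subdiv s)) C.
Proof. exact: parity_flatten. Qed.

Lemma boundary_csubdiv a C :
  parity a (cboundary (csubdiv C)) = parity a (csubdiv (cboundary C)).
Proof.
rewrite parity_cboundary !parity_csubdiv parity_cboundary.
by apply: eq_parity => s; rewrite -parity_cboundary boundary_subdiv parity_csubdiv.
Qed.

Lemma parity_iter_csubdiv r C C' : (forall a, parity a C = parity a C') ->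
  forall a, parity a (iter r (@csubdiv R _) C) = parity a (iter r (@csubdiv R _) C').
Proof. by move=> CC'; elim: r => //= r IH a; rewrite !parity_csubdiv. Qed.

Lemma boundary_iter_csubdiv r a C :
  parity a (cboundary (iter r (@csubdiv R _) C)) =
  parity a (iter r (@csubdiv R _) (cboundary C)).
Proof.
elim: r a => //= r IH a; rewrite boundary_csubdiv !parity_csubdiv; exact: IH.
Qed.

Lemma iter_csubdivN r C : iter r (@csubdiv R _) (map (map -%R) C) =
  map (map -%R) (iter r (@csubdiv R _) C).
Proof. by elim: r => //= r ->; rewrite csubdivN. Qed.

(* The face of the cross-polytope boundary with sign pattern [b] spanned by the
   first [k] axes. *)
Definition orthant (b : 'I_n.+1 -> bool) k : pred V := fun x =>
  [&& [forall i, 0 <= (-1) ^+ b i * x ord0 i],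
      \sum_i (-1) ^+ b i * x ord0 i == 1
    & [forall i : 'I_n.+1, (k <= i)%N ==> (x ord0 i == 0)]].

Lemma orthant_barycenter b k s :
  s != [::] -> all (orthant b k) s -> orthant b k (barycenter s).
Proof.
move=> s0 /allP sb; have n0 : (0 : R) < (size s)%:R by rewrite ltr0n lt0n size_eq0.
have E i : (-1) ^+ b i * barycenter s ord0 i =
    (size s)%:R^-1 * \sum_(x <- s) (-1) ^+ b i * x ord0 i.
  by rewrite barycenter_coord mulrCA mulr_sumr.
apply/and3P; split.
- apply/forallP => i; rewrite E; apply: mulr_ge0; first by rewrite invr_ge0 ltW.
  by rewrite big_seq; apply: sumr_ge0 => x /sb /and3P[/forallP].
- under eq_bigr do rewrite E.
  rewrite -mulr_sumr exchange_big /= (eq_big_seq (fun=> 1)) => [|x /sb /and3P[_ /eqP]//].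
  by rewrite big_const_seq count_predT iter_addr_0 mulVf ?eqxx ?gt_eqF.
- apply/forallP => i; apply/implyP => ki; rewrite barycenter_coord big_seq big1 ?mulr0 //.
  by move=> x /sb /and3P[_ _ /forallP/(_ i)/implyP/(_ ki)/eqP].
Qed.

Lemma orthant_l1norm b k x : orthant b k x -> l1norm x = 1.
Proof.
move=> /and3P[/forallP x0 /eqP x1 _]; apply: etrans x1; apply: eq_bigr => i _.
by rewrite -(ger0_norm (x0 i)) normrM normr_sign mul1r.
Qed.

Lemma orthantN b k x : orthant b k x -> orthant (fun i => ~~ b i) k (- x).
Proof.
move=> /and3P[/forallP x0 /eqP x1 /forallP xk]; apply/and3P; split.
- by apply/forallP => i; rewrite mxE /= signrN mulrNN.
- by apply/eqP; apply: etrans x1; apply: eq_bigr => i _; rewrite mxE /= signrN mulrNN.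
- by apply/forallP => i; rewrite mxE oppr_eq0; apply: xk.
Qed.

(** Resets the sign of coordinate [k] to plus, so that the orthant also contains the new apex;
    points whose coordinate [k] is zero are not affected. *)
Definition widen_sign (b : 'I_n.+1 -> bool) k (i : 'I_n.+1) := (i != k :> nat) && b i.

Lemma orthant_axis b k : (k <= n)%N -> orthant (widen_sign b k) k.+1 (axis k).
Proof.
move=> kn; have E i : (-1) ^+ widen_sign b k i * axis k ord0 i = (i == inord k)%:R.
  rewrite mxE eqxx /=; have [->|_] := eqVneq i (inord k); rewrite ?mulr0 //.
  by rewrite /widen_sign inordK // eqxx mulr1.
apply/and3P; split.
- by apply/forallP => i; rewrite E ler0n.
- under eq_bigr do rewrite E.
  by rewrite (bigD1 (inord k)) //= eqxx big1 ?addr0 // => i /negbTE ->.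
- apply/forallP => i; apply/implyP => ki; rewrite mxE eqxx /=.
  by have [ik|_] := eqVneq i (inord k); rewrite ?eqxx //; move: ki; rewrite ik inordK ?ltnn.
Qed.

Lemma orthant_widen b k x : orthant b k x -> orthant (widen_sign b k) k.+1 x.
Proof.
move=> /and3P[/forallP x0 /eqP x1 /forallP xk].
have E i : (-1) ^+ widen_sign b k i * x ord0 i = (-1) ^+ b i * x ord0 i.
  rewrite /widen_sign; case: eqVneq => //= ik.
  by have /implyP/(_ _)/eqP -> := xk i; rewrite ?ik ?leqnn ?mulr0.
apply/and3P; split.
- by apply/forallP => i; rewrite E.
- by apply/eqP; apply: etrans x1; apply: eq_bigr => i _; rewrite E.
- by apply/forallP => i; apply/implyP => /ltnW ki; have /implyP := xk i; apply.
Qed.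

Lemma hemisphere_orthant_rec k : (k <= n)%N ->
  (forall s, s \in cross k -> size s = k /\ exists b, all (orthant b k) s) ->
  forall s, s \in hemisphere k -> size s = k.+1 /\
    exists2 b, (forall i : 'I_n.+1, i = k :> nat -> b i = false) & all (orthant b k.+1) s.
Proof.
move=> kn h s /mapP[t /h [st [b tb]] ->]; split; first by rewrite /= st.
exists (widen_sign b k); first by move=> i ik; rewrite /widen_sign ik eqxx.
by rewrite /= orthant_axis //; apply: sub_all tb; apply: orthant_widen.
Qed.

Lemma cross_orthant k : (k <= n.+1)%N ->
  forall s, s \in cross k -> size s = k /\ exists b, all (orthant b k) s.
Proof.
elim: k => [|k IH] kn s; first by rewrite inE => /eqP ->; split => //; exists xpredT.
have h := @hemisphere_orthant_rec k kn (IH (ltnW kn)).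
rewrite mem_cat => /orP[/h[-> [b _ sb]]|/mapP[t /h[<- [b _ /allP tb]] ->]].
  by split => //; exists b.
rewrite size_map; split => //; exists (fun i => ~~ b i); rewrite all_map.
by apply/allP => x /tb /orthantN.
Qed.

Lemma hemisphere_orthant k : (k <= n)%N ->
  forall s, s \in hemisphere k -> size s = k.+1 /\
    exists2 b, (forall i : 'I_n.+1, i = k :> nat -> b i = false) & all (orthant b k.+1) s.
Proof. by move=> kn; apply: hemisphere_orthant_rec => //; apply: cross_orthant; apply: ltnW. Qed.

End Fan.

(** * Fan's lemma for fine subdivisions *)

Section FanHemisphere.
Variables (R : realType) (n : nat).
Let V := 'rV[R]_n.+1.
Implicit Types (s t : seq V) (C : seq (seq V)) (x y : V).

Lemma mem_iter_csubdiv r C s : s \in iter r (@csubdiv R n.+1) C ->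
  exists2 t, t \in C & [/\ size s = size t,
    forall P : pred V, (forall u, u != [::] -> all P u -> P (barycenter u)) ->
      all P t -> all P s &
    forall k D, 0 <= D -> (size t <= k.+1)%N -> diam_le D t ->
      diam_le ((1 - k.+1%:R^-1) ^+ r * D) s].
Proof.
elim: r s => [|r IH] s /=.
  by move=> sC; exists s => //; split => // k D _ _; rewrite mul1r.
move=> /flatten_mapP[u /IH[t tC [ut tP tD]] su]; exists t => //; split.
- by rewrite (size_subdiv su).
- by move=> P hP /(tP _ hP) uP; apply: subdiv_convex su.
- move=> k D D0 tk /(tD _ _ D0 tk) uD; rewrite exprS -mulrA.
  apply: diam_subdiv su; rewrite ?ut //.
  by rewrite mulr_ge0 // exprn_ge0 // subr_ge0 invf_le1 ?ler1n ?ltr0n.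
Qed.

Lemma l1norm_coord m (x : 'rV[R]_m) i : `|x ord0 i| <= l1norm x.
Proof. by rewrite /l1norm (bigD1 i) //= lerDl sumr_ge0. Qed.

Lemma expr_small (c e : R) : 0 <= c -> c < 1 -> 0 < e -> exists r, c ^+ r <= e.
Proof.
move=> c0 c1 e0; have h : `|c| < 1 by rewrite ger0_norm.
have /cvgrPdist_le/(_ _ e0)[r _ /(_ r (leqnn r))] := cvg_expr h.
by rewrite sub0r normrN ger0_norm ?exprn_ge0 //; exists r.
Qed.

(** The parity of alternating simplices is carried down through the dimensions to the empty simplex,
    and an alternating simplex has distinct absolute labels. The top hemisphere is never doubled, so
    antipodal labels are required on the equator only. *)
Lemma hemisphere_fan (lab : V -> nat) (e : R) : 0 < e ->
  (forall x, l1norm x = 1 -> x ord0 ord_max = 0 -> lab (- x) = flip (lab x)) ->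
  (forall x y, l1norm x = 1 -> l1norm y = 1 ->
     0 <= x ord0 ord_max -> 0 <= y ord0 ord_max ->
     close e x y -> lab x != flip (lab y)) ->
  exists s : seq V, [/\ size s = n.+1,
    {in s, forall x, l1norm x = 1 /\ 0 <= x ord0 ord_max},
    diam_le e s & uniq (map half (map lab s))].
Proof.
move=> e0 labN labC.
(* Points of l1 norm 1 differ by at most 2 in each coordinate, hence the target [e / 2] for the
   shrinking factor. *)
have [r re] : exists r, (1 - n.+1%:R^-1 : R) ^+ r <= e / 2.
  apply: expr_small; rewrite ?divr_gt0 ?subr_ge0 ?invf_le1 ?ler1n ?ltr0n //.
  by rewrite ltrBlDr ltrDl invr_gt0 ltr0n.
pose H k := iter r (@csubdiv R n.+1) (hemisphere R n k).
(* Hemispheres of dimension below [n] lie in the equator, where the labelling is antipodal; the last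
   clause records this. *)
have HP k s : (k <= n)%N -> s \in H k -> [/\ size s = k.+1, diam_le e s,
    {in s, forall x, l1norm x = 1 /\ 0 <= x ord0 ord_max} &
    (k < n)%N -> {in s, forall x, x ord0 ord_max = 0}].
  move=> kn /mem_iter_csubdiv[t /(hemisphere_orthant kn)[tk [b bk tb]] [st sP sD]].
  have /allP sb := sP _ (@orthant_barycenter _ _ b k.+1) tb.
  split; first by rewrite st.
  - have tD : diam_le 2 t.
      apply/allrelP => x y /(allP tb)/orthant_l1norm x1 /(allP tb)/orthant_l1norm y1.
      apply/forallP => i; apply: le_trans (ler_normB _ _) _.
      have := l1norm_coord x i; have := l1norm_coord y i; rewrite x1 y1; lra.
    have /allrelP h : diam_le ((1 - n.+1%:R^-1) ^+ r * 2) s.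
      by apply: sD => //; rewrite tk.
    apply/allrelP => x y xs ys; apply: close_le (h _ _ xs ys).
    by rewrite -ler_pdivlMr ?ltr0n.
  - move=> x /sb xb; rewrite (orthant_l1norm xb); split=> //.
    move: xb => /and3P[/forallP/(_ ord_max) x0 _ /forallP/(_ ord_max)/implyP xk].
    move: kn x0 xk; rewrite leq_eqVlt => /orP[/eqP kn|kn] x0 xk.
      by move: x0; rewrite bk ?expr0 ?mul1r.
    by move: (xk kn) => /eqP ->.
  - move=> kn' x /sb /and3P[_ _ /forallP/(_ ord_max)/implyP/(_ kn')/eqP //].
have nc k s : (k <= n)%N -> s \in H k -> {in map lab s &, forall i j, i != flip j}.
  move=> kn /(HP _ _ kn)[_ /allrelP sD s1 _] _ _ /mapP[x xs ->] /mapP[y ys ->].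
  have [x1 x0] := s1 _ xs; have [y1 y0] := s1 _ ys.
  by apply: labC => //; apply: sD.
pose a b s := alternates b (map lab s).
(* The coboundary identity, summed over [H k], whose boundary is the subdivided [cross k]. *)
have step k : (k <= n)%N ->
    parity (fun s => a true s (+) a false s) (H k) =
    parity (a true) (iter r (@csubdiv R n.+1) (cross R n k)).
  move=> kn; rewrite -(parity_iter_csubdiv r (boundary_hemisphere (@boundary_cross R n k))).
  rewrite -boundary_iter_csubdiv parity_cboundary; apply: eq_parity => s.
  by rewrite /a -parity_alternates boundary_map parity_map.
(* [cross k.+1] is [hemisphere k] plus its antipode, on which antipodal labels turn [a true] into
   [a false]. By [step] the parity equals that of [cross k], and at the bottom the empty simplex
   alternates. *)
have odd_cross k : (k <= n)%N -> parity (a true) (iter r (@csubdiv R n.+1) (cross R n k)).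
  elim: k => [|k IH] kn.
    have E i : iter i (@csubdiv R n.+1) [:: [::]] = [:: [::]] by elim: i => //= i ->.
    by rewrite /= E /parity big_cons big_nil.
  apply: etrans (IH (ltnW kn)); rewrite -(step _ (ltnW kn)) crossS.
  have E C1 C2 : iter r (@csubdiv R n.+1) (C1 ++ C2) =
      iter r (@csubdiv R n.+1) C1 ++ iter r (@csubdiv R n.+1) C2.
    by elim: (r) => //= i ->; rewrite /csubdiv map_cat flatten_cat.
  rewrite E parity_cat iter_csubdivN parity_map [in RHS]parity_addb; congr (_ (+) _).
  apply: eq_in_parity => s sH /=; rewrite /a.
  rewrite -[false]/(~~ true) -alternates_flip; last exact: (nc _ _ (ltnW kn) sH).
  congr alternates; rewrite -!map_comp; apply/eq_in_map => x xs /=.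
  have [_ _ s1 s0] := HP _ _ (ltnW kn) sH.
  by apply: labN; [have [] := s1 _ xs | apply: s0].
have := odd_cross n (leqnn n); rewrite -step //.
have [/hasP[s sH al] _|/hasPn no] := boolP (has (fun s => a true s || a false s) (H n)).
  have [sn sD s1 _] := HP _ _ (leqnn n) sH; exists s; split => //.
  by case/orP: al; apply: alternates_uniq; apply: (nc _ _ (leqnn n) sH).
rewrite (@eq_in_parity _ _ (fun=> false)) ?parity0 // => s /no.
by case: (a true s); case: (a false s).
Qed.

End FanHemisphere.

(** * Uniformly continuous homeomorphism with the sphere of the l1 norm *)

Section UniformContinuity.
Variable R : realType.

Lemma close_ball m (x y : 'rV[R]_m) (e : R) : 0 < e ->
  (forall i, `|x ord0 i - y ord0 i| < e) -> ball x e y.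
Proof. by move=> e0 h; split => // i j; rewrite ord1 -ball_normE; apply: h. Qed.

Lemma ball_close m (x y : 'rV[R]_m) (e : R) : ball x e y -> close e x y.
Proof.
move=> [_ h]; apply/forallP => i; have := h ord0 i.
by rewrite -ball_normE => /ltW.
Qed.

Lemma close_trans m (d e : R) (x y z : 'rV[R]_m) :
  close d x y -> close e y z -> close (d + e) x z.
Proof.
move=> /forallP xy /forallP yz; apply/forallP => i.
exact: le_trans (ler_distD (y ord0 i) _ _) (lerD (xy i) (yz i)).
Qed.

Definition unif_cont m k (A : set 'rV[R]_m) (f : 'rV[R]_m -> 'rV[R]_k) :=
  forall e, 0 < e -> exists2 d, 0 < d &
    forall x y, A x -> A y -> close d x y -> close e (f x) (f y).

(** The Heine-Cantor theorem, from the covering form of compactness: a modulus that works near each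
    point works on all of [A]. *)
Lemma compact_unif_cont m k (A : set 'rV[R]_m) (f : 'rV[R]_m -> 'rV[R]_k) :
  compact A -> {within A, continuous f} -> unif_cont A f.
Proof.
move=> /compact_near_coveringP cA /subspace_continuousP fc e e0.
have e20 : 0 < e / 2 by rewrite divr_gt0.
pose P (d : R) x := A x -> forall y, A y -> close d x y -> close e (f x) (f y).
have [] := cA R (0^'+)%classic P.
  move=> x Ax; have /(_ (ball (f x) (e / 2))) := fc x Ax.
  move=> /(_ (nbhsx_ballx _ _ e20)) /nbhs_ballP[d /= d0 dx].
  have d20 : 0 < d / 2 by rewrite divr_gt0.
  (* A point within [r] of a point of the ball of radius [d / 2] stays in the ball of radius [d],
     where [f] varies by less than [e / 2] from its value at the centre. *)
  have dr (r : R) : r <= d / 3 -> d / 2 + r < d by move: d0; lra.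
  near=> x' r => Ax' y Ay x'y.
  have rd : r <= d / 3.
    by near: r; apply: nbhs_right_le; rewrite divr_gt0.
  have xx' : ball x (d / 2) x' by near: x'; exact: nbhsx_ballx.
  have fx' : close (e / 2) (f x) (f x').
    by apply: ball_close; apply: dx => //; apply: le_ball xx'; lra.
  have fy : close (e / 2) (f x) (f y).
    apply: ball_close; apply: dx => //; apply: close_ball => // i.
    have := ball_close xx'; move=> /forallP/(_ i) h1; have /forallP/(_ i) h2 := x'y.
    apply: le_lt_trans (ler_distD (x' ord0 i) _ _) _.
    apply: le_lt_trans (lerD h1 h2) _.
    exact: dr.
  rewrite close_sym in fx'; rewrite [e]splitr; exact: close_trans fx' fy.
move=> d /= d0 h; exists (d / 2); first by rewrite divr_gt0.
move=> x y Ax Ay xy; apply: (h (d / 2)) => //=; last by rewrite divr_gt0.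
by rewrite sub0r normrN gtr0_norm ?divr_gt0 //; lra.
Unshelve. all: by end_near.
Qed.

Lemma sum_coord_continuous m (h : R -> R) : continuous h ->
  continuous (fun x : 'rV[R]_m => \sum_i h (x ord0 i)).
Proof.
move=> hc; apply: continuous_big; first exact: add_continuous.
move=> i _ x; apply: continuous_comp; [exact: coord_continuous | exact: hc].
Qed.

Lemma bounded_by1_compact m (A : set 'rV[R]_m) :
  (forall x, A x -> forall i, `|x ord0 i| <= 1) -> closed A -> compact A.
Proof.
move=> A1; apply: bounded_closed_compact; exists 1; split => // M M1 x Ax.
apply: ltW; apply: le_lt_trans M1; rewrite -[`|x|]/(mx_norm x) mx_normrE.
by apply/bigmax_leP; split => //= -[i j] _ /=; rewrite ord1; apply: A1.
Qed.

Lemma sphere_compact d : compact (@sphere R d).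
Proof.
apply: bounded_by1_compact => [x x1 i|].
  rewrite -(@expr_le1 _ 2) // -normrX ger0_norm ?sqr_ge0 // -[leRHS]x1 (bigD1 i) //=.
  by rewrite lerDl sumr_ge0 // => j _; rewrite sqr_ge0.
apply: (@closed_comp _ _ (fun x : 'rV[R]_d => \sum_i x ord0 i ^+ 2) [set x | x = 1]).
  move=> x _; apply: (@sum_coord_continuous d (fun y => y ^+ 2)) => y.
  exact: (cvgM cvg_id cvg_id).
exact: closed_eq.
Qed.

Lemma realization_compact n (K : scomplex 'I_n) : compact (@realization R n K).
Proof.
(* Having a given support exactly is not a closed condition; vanishing outside [A] is. The
   realization is the finite union of these closed simplices because faces are closed under
   subsets. *)
pose F (A : {set 'I_n}) : set 'rV[R]_n :=
  [set x | \sum_i x ord0 i = 1] `&` \bigcap_(i in [set: 'I_n])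
   ([set x | 0 <= x ord0 i] `&` [set x | i \notin A -> x ord0 i = 0]).
have FE : @realization R n K = \big[setU/set0]_(A <- enum (faces K)) F A.
  apply/seteqP; split => x.
    move=> [x0 x1 xK]; rewrite -bigcup_seq; exists [set i | x ord0 i != 0]%SET.
      by rewrite /= mem_enum.
    split => // i _; split => /=; first exact: x0.
    by rewrite inE negbK => /eqP.
  rewrite -bigcup_seq => -[A /=]; rewrite mem_enum => AK [x1 xA]; split => //.
    by move=> i; have [] := xA i I.
  apply: (@sub_face _ K _ A _ AK); apply/fintype.subsetP => i; rewrite inE; apply: contraR => iA.
  by have [_ ->] := xA i I.
rewrite FE; apply: bounded_by1_compact.
  rewrite -FE => x [x0 x1 _] i; rewrite ger0_norm // -x1 (bigD1 i) //= lerDl.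
  by rewrite sumr_ge0.
apply: closed_bigsetU => A _; apply: closedI.
  apply: (@closed_comp _ _ (fun x : 'rV[R]_n => \sum_i x ord0 i) [set x | x = 1]).
    by move=> x _; apply: (@sum_coord_continuous n idfun) => y; apply: cvg_id.
  exact: closed_eq.
apply: closed_bigI => i _; apply: closedI.
  apply: (@closed_comp _ _ (fun x : 'rV[R]_n => x ord0 i) [set x | 0 <= x]).
    by move=> x _; apply: coord_continuous.
  exact: closed_ge.
have [iA|iA] := boolP (i \in A).
  by rewrite (_ : mkset _ = setT) ?closedT //; apply/seteqP; split.
rewrite [X in closed X](_ : _ = (fun x : 'rV[R]_n => x ord0 i) @^-1` [set x | x = 0]).
  by apply: closed_comp => [x _|]; [exact: coord_continuous | exact: closed_eq].
by apply/seteqP; split => x /= => [/(_ isT)|].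
Qed.

End UniformContinuity.

(** * Radial projection between the Euclidean sphere and the l1 sphere *)

Section L1Sphere.
Variable R : realType.

Definition l2norm m (x : 'rV[R]_m) : R := Num.sqrt (\sum_i x ord0 i ^+ 2).

Definition l1sphere m : set 'rV[R]_m := [set x | l1norm x = 1].

Definition normalize m (N : 'rV[R]_m -> R) (x : 'rV[R]_m) := (N x)^-1 *: x.

Definition pos_homogeneous m (N : 'rV[R]_m -> R) :=
  forall a x, 0 <= a -> N (a *: x) = a * N x.

Lemma l1norm_homogeneous m : pos_homogeneous (@l1norm R m).
Proof.
move=> a x a0; rewrite /l1norm mulr_sumr; apply: eq_bigr => i _.
by rewrite mxE normrM ger0_norm.
Qed.

Lemma l2norm_homogeneous m : pos_homogeneous (@l2norm m).
Proof.
move=> a x a0; rewrite /l2norm -{2}(ger0_norm a0) -sqrtr_sqr -sqrtrM ?sqr_ge0 //.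
by rewrite mulr_sumr; congr Num.sqrt; apply: eq_bigr => i _; rewrite mxE exprMn.
Qed.

Lemma normalize_norm m (N : 'rV[R]_m -> R) x :
  pos_homogeneous N -> 0 < N x -> N (normalize N x) = 1.
Proof. by move=> hN x0; rewrite hN ?invr_ge0 ?ltW // mulVf ?gt_eqF. Qed.

Lemma normalizeK m (N M : 'rV[R]_m -> R) x :
  pos_homogeneous N -> N x = 1 -> 0 < M x -> normalize N (normalize M x) = x.
Proof.
move=> hN x1 x0; rewrite /normalize hN ?invr_ge0 ?ltW // x1 mulr1 invrK.
by rewrite scalerA mulfV ?gt_eqF // scale1r.
Qed.

Lemma normalize_unif_cont m (A : set 'rV[R]_m) (N : 'rV[R]_m -> R) (c L : R) :
  0 < c -> 0 <= L -> (forall x, A x -> c <= N x) ->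
  (forall x i, A x -> `|x ord0 i| <= 1) ->
  (forall x y d, 0 < d -> A x -> A y -> close d x y -> `|N x - N y| <= L * d) ->
  unif_cont A (normalize N).
Proof.
move=> c0 L0 cN A1 NL e e0.
have cL : 0 < c + L by rewrite ltr_wpDr.
(* Chosen so that [d / c + L * d / c ^+ 2 = e]; the two terms bound the changes due to the point and
   to its norm. *)
pose d := e * c ^+ 2 / (c + L).
have d0 : 0 < d by rewrite divr_gt0 // mulr_gt0 // exprn_gt0.
exists d => // x y Ax Ay xy; apply/forallP => i; rewrite !mxE.
have Nx := cN _ Ax; have Ny := cN _ Ay; have h := NL x y d d0 Ax Ay xy.
have Nx0 : 0 < N x := lt_le_trans c0 Nx; have Ny0 : 0 < N y := lt_le_trans c0 Ny.
have -> : (N x)^-1 * x ord0 i - (N y)^-1 * y ord0 i =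
    (x ord0 i - y ord0 i) / N x + y ord0 i * ((N y - N x) / (N x * N y)).
  by field; rewrite !gt_eqF.
apply: le_trans (ler_normD _ _) _; rewrite !normrM.
have -> : e = d / c + 1 * (L * d / (c * c)).
  by rewrite /d; field; rewrite !gt_eqF.
rewrite !normfV !(gtr0_norm (mulr_gt0 Nx0 Ny0)) !(gtr0_norm Nx0).
have inv_le (a b : R) : 0 < a -> a <= b -> b^-1 <= a^-1.
  by move=> a0 ab; rewrite lef_pV2 ?posrE //; apply: lt_le_trans ab.
apply: lerD.
  apply: ler_pM; [by [] | by rewrite invr_ge0 ltW | | exact: inv_le].
  by have /forallP := xy; apply.
apply: ler_pM => //; [by rewrite mulr_ge0 // invr_ge0 mulr_ge0 // ltW | exact: A1 |].
apply: ler_pM; [by []| by rewrite invr_ge0 ltW // mulr_gt0 | by rewrite distrC |].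
by apply: inv_le; rewrite ?mulr_gt0 // ler_pM // ltW.
Qed.

Lemma l1norm_lipschitz m (x y : 'rV[R]_m) d : close d x y ->
  `|l1norm x - l1norm y| <= m%:R * d.
Proof.
move=> /forallP xy; rewrite /l1norm -sumrB; apply: le_trans (ler_norm_sum _ _ _) _.
have -> : m%:R * d = \sum_(i < m) d by rewrite sumr_const card_ord mulr_natl.
apply: ler_sum => i _; apply: le_trans (xy i); exact: ler_dist_dist.
Qed.

Lemma l2norm_coord m (x : 'rV[R]_m) i : `|x ord0 i| <= l2norm x.
Proof.
rewrite -sqrtr_sqr ler_wsqrtr // (bigD1 i) //= lerDl.
by apply: sumr_ge0 => j _; rewrite sqr_ge0.
Qed.

Lemma l1norm_le_l2norm m (x : 'rV[R]_m) : l1norm x <= m%:R * l2norm x.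
Proof.
have -> : m%:R * l2norm x = \sum_(i < m) l2norm x by rewrite sumr_const card_ord mulr_natl.
by apply: ler_sum => i _; apply: l2norm_coord.
Qed.

(** Writing [d.+1] instead of [d] keeps the bound meaningful in dimension zero. *)
Lemma l2norm_ge_l1sphere d (x : 'rV[R]_d) : l1norm x = 1 -> d.+1%:R^-1 <= l2norm x.
Proof.
move=> x1; rewrite -div1r ler_pdivrMr ?ltr0n //.
have := l1norm_le_l2norm x; rewrite x1 => h; apply: le_trans h _.
by rewrite mulrC ler_wpM2l ?sqrtr_ge0 // ler_nat.
Qed.

(** Divide the difference of the squared norms, at most [2 * d * e], by the sum of the norms, at
    least [2 / d.+1]. *)
Lemma l2norm_lipschitz d (x y : 'rV[R]_d) e : l1norm x = 1 -> l1norm y = 1 ->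
  close e x y -> `|l2norm x - l2norm y| <= d.+1%:R ^+ 2 * e.
Proof.
move=> x1 y1 xy; set D : R := d.+1%:R; have D0 : 0 < D by rewrite ltr0n.
(* In dimension zero closeness does not force [e] to be nonnegative, but then no point has l1 norm
   1. *)
have e0 : 0 <= e \/ d = 0%N.
  case: d x y x1 y1 xy @D D0 => [|d] x y x1 y1 /forallP xy D D0; [by right|left].
  exact: le_trans (normr_ge0 _) (xy ord0).
case: e0 => [e0|d0]; last first.
  by move: x1; rewrite /l1norm; subst d; rewrite big_ord0 => /eqP; rewrite eq_sym oner_eq0.
have xD := l2norm_ge_l1sphere x1; have yD := l2norm_ge_l1sphere y1.
have s0 : 0 < l2norm x + l2norm y.
  by rewrite addr_gt0 // (lt_le_trans _ xD, lt_le_trans _ yD) // invr_gt0.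
rewrite -(ler_pM2r s0) -{1}(gtr0_norm s0) -normrM -subr_sqr.
rewrite !sqr_sqrtr ?sumr_ge0 // => [|i _|i _]; rewrite ?sqr_ge0 //.
rewrite -sumrB; apply: le_trans (ler_norm_sum _ _ _) _.
have b i : `|x ord0 i ^+ 2 - y ord0 i ^+ 2| <= 2 * e.
  rewrite subr_sqr normrM mulrC ler_pM //; last by have /forallP := xy.
  have := l1norm_coord x i; have := l1norm_coord y i; rewrite x1 y1.
  by have := ler_normD (x ord0 i) (y ord0 i); lra.
apply: le_trans (ler_sum _ (fun i _ => b i)) _.
rewrite sumr_const card_ord -[leLHS]mulr_natl.
have dD : d%:R <= D by rewrite ler_nat.
have h : 2 * D^-1 <= l2norm x + l2norm y.
  by move: xD yD; rewrite -/D; move: (D^-1) => E xE yE; lra.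
have := ler_wpM2l (mulr_ge0 (sqr_ge0 D) e0) h.
have field_eq (a c : R) : 0 < a -> a ^+ 2 * c * (2 * a^-1) = a * (2 * c).
  by move=> a0; field; rewrite gt_eqF.
rewrite field_eq //.
by move=> h'; apply: le_trans h'; rewrite ler_wpM2r // mulr_ge0.
Qed.

Lemma unif_cont_comp m k l (A : set 'rV[R]_m) (B : set 'rV[R]_k) f
    (g : 'rV[R]_k -> 'rV[R]_l) :
  (forall x, A x -> B (f x)) -> unif_cont A f -> unif_cont B g ->
  unif_cont A (g \o f).
Proof.
move=> AB fc gc e e0; have [d d0 dg] := gc e e0; have [c c0 cf] := fc d d0.
by exists c => // x y Ax Ay xy; apply: dg (AB _ Ax) (AB _ Ay) (cf _ _ Ax Ay xy).
Qed.

Lemma sphere_l2norm d (x : 'rV[R]_d) : sphere x -> l2norm x = 1.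
Proof. by rewrite /l2norm => ->; rewrite sqrtr1. Qed.

Lemma sphere_l1norm d (x : 'rV[R]_d) : sphere x -> 1 <= l1norm x.
Proof.
move=> sx; have x1 := sphere_l2norm sx; rewrite -[leLHS]sx; apply: ler_sum => i _.
rewrite -(real_normK (num_real _)) expr2 ler_piMr //.
by rewrite -x1 l2norm_coord.
Qed.

Lemma l1sphere_l2norm d (x : 'rV[R]_d) : l1norm x = 1 -> 0 < l2norm x.
Proof. by move/l2norm_ge_l1sphere; apply: lt_le_trans; rewrite invr_gt0 ltr0n. Qed.

(** Composing with the radial projections moves the triangulation to the sphere on which Fan's lemma
    is stated; compactness makes both directions uniformly continuous. *)
Lemma triangulation_l1sphere n d (K : scomplex 'I_n) :
  triangulates_sphere R d K ->
  exists f : 'rV[R]_n -> 'rV[R]_d, exists g : 'rV[R]_d -> 'rV[R]_n,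
  [/\ unif_cont (@realization R n K) f, unif_cont (@l1sphere d) g,
      forall x, realization K x -> l1norm (f x) = 1 /\ g (f x) = x &
      forall y, l1norm y = 1 -> realization K (g y) /\ f (g y) = y].
Proof.
move=> [f [g [fc gc gf fg]]].
have n12 x : l1norm x = 1 -> sphere (normalize (@l2norm d) x).
  move=> /l1sphere_l2norm x0; have := normalize_norm (@l2norm_homogeneous d) x0.
  rewrite /l2norm => /(congr1 (fun y => y ^+ 2)); rewrite sqr_sqrtr ?expr1n //.
  by apply: sumr_ge0 => i _; rewrite sqr_ge0.
have l1gt0 (x : 'rV[R]_d) : sphere x -> 0 < l1norm x.
  by move=> xS; exact: lt_le_trans ltr01 (sphere_l1norm xS).
have n21 (x : 'rV[R]_d) : sphere x -> l1norm (normalize (@l1norm R d) x) = 1.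
  by move=> xS; apply: normalize_norm (l1gt0 _ xS); apply: l1norm_homogeneous.
exists (normalize (@l1norm R d) \o f), (g \o normalize (@l2norm d)); split.
- apply: (@unif_cont_comp _ _ _ _ (@sphere R d)) => [x /gf[]//||].
    exact: compact_unif_cont (@realization_compact R _ K) fc.
  apply: (@normalize_unif_cont _ _ _ 1 d%:R) => //.
  + exact: sphere_l1norm.
  + by move=> x i xS; rewrite -(sphere_l2norm xS) l2norm_coord.
  + by move=> x y e _ _ _; apply: l1norm_lipschitz.
- apply: (@unif_cont_comp _ _ _ _ (@sphere R d)) => [x /n12//||].
    apply: (@normalize_unif_cont _ _ _ d.+1%:R^-1 (d.+1%:R ^+ 2)).
    + by rewrite invr_gt0 ltr0n.
    + by rewrite exprn_ge0.
    + exact: l2norm_ge_l1sphere.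
    + by move=> x i <-; apply: l1norm_coord.
    + by move=> x y e _; apply: l2norm_lipschitz.
  exact: compact_unif_cont (@sphere_compact R d) gc.
- move=> x /gf[fx gfx]; split; first exact: n21.
  rewrite /= normalizeK ?gfx ?sphere_l2norm ?l1gt0 //; exact: l2norm_homogeneous.
- move=> y y1; have [gy fgy] := fg _ (n12 _ y1); split => //=.
  by rewrite fgy normalizeK // ?l1sphere_l2norm //; apply: l1norm_homogeneous.
Qed.

End L1Sphere.

(** * Lower bound *)

Section LowerBound.
Variables (R : realType) (n d : nat) (K : scomplex 'I_n).
Variables (f : 'rV[R]_n -> 'rV[R]_d) (g : 'rV[R]_d -> 'rV[R]_n).
Implicit Types (x y z : 'rV[R]_n).
Hypothesis f_unif : unif_cont (@realization R n K) f.
Hypothesis g_unif : unif_cont (@l1sphere R d) g.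
Hypothesis fK : forall x, realization K x -> l1norm (f x) = 1 /\ g (f x) = x.

Definition mass (x : 'rV[R]_n) : R := \sum_i x ord0 i.

Definition support (x : 'rV[R]_n) : {set 'I_n} := [set i | x ord0 i != 0]%SET.

(** The cone over the realization with apex the origin; the mass is the cone parameter. *)
Definition cone : set 'rV[R]_n :=
  [set x : 'rV[R]_n | [/\ forall i, 0 <= x ord0 i, mass x <= 1 & support x \in faces K]].

(** The homogeneous extension of [f]; the factor [mass x] makes it zero at the apex, whatever [f]
    does there. *)
Definition cone_ext (x : 'rV[R]_n) : 'rV[R]_d := mass x *: f ((mass x)^-1 *: x).

Lemma mass_ge0 x : cone x -> 0 <= mass x.
Proof. by move=> [x0 _ _]; apply: sumr_ge0. Qed.

Lemma coord_le_mass x i : cone x -> `|x ord0 i| <= mass x.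
Proof.
move=> [x0 _ _]; rewrite ger0_norm // /mass (bigD1 i) //= lerDl.
exact: sumr_ge0.
Qed.

Lemma cone_realization x : cone x -> 0 < mass x -> realization K ((mass x)^-1 *: x).
Proof.
move=> [x0 _ xK] m0; split.
- by move=> i; rewrite mxE mulr_ge0 // invr_ge0 ltW.
- under eq_bigr do rewrite mxE.
  by rewrite -mulr_sumr mulVf // gt_eqF.
- rewrite (_ : [set _ | _]%SET = support x) //.
  by apply/setP => i; rewrite !inE mxE mulf_eq0 invr_eq0 gt_eqF.
Qed.

Lemma cone_ext_coord x i : cone x -> `|cone_ext x ord0 i| <= mass x.
Proof.
move=> xc; have := mass_ge0 xc; rewrite le_eqVlt => /predU1P[m0|m0].
  by rewrite /cone_ext -m0 scale0r mxE normr0.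
rewrite mxE normrM gtr0_norm //; apply: ler_piMr; first exact: ltW.
have [<- _] := fK (cone_realization xc m0); exact: l1norm_coord.
Qed.

Lemma mass_lipschitz x y e : close e x y -> `|mass x - mass y| <= n%:R * e.
Proof.
move=> /forallP xy; rewrite /mass -sumrB; apply: le_trans (ler_norm_sum _ _ _) _.
have -> : n%:R * e = \sum_(i < n) e by rewrite sumr_const card_ord mulr_natl.
by apply: ler_sum => i _; apply: xy.
Qed.

(** Near the apex the values are bounded by the mass; away from it, projecting to mass 1 is
    uniformly continuous. *)
Lemma cone_ext_unif : unif_cont cone cone_ext.
Proof.
move=> e e0; have e20 : 0 < e / 2 by rewrite divr_gt0.
have [r r0 fr] := f_unif e20.
have e40 : 0 < e / 4 by rewrite divr_gt0.
have n0 : (0 : R) < n.+1%:R by rewrite ltr0n.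
(* The first bound keeps masses within [e / 4]; the second keeps the projections of points of mass
   above [e / 4] within [r]. *)
pose a := Num.min (e / 4) (r * (e / 4)) / n.+1%:R.
have a0 : 0 < a by rewrite divr_gt0 // lt_min e40 mulr_gt0.
have na1 : n%:R * a <= e / 4.
  apply: (@le_trans _ _ (n.+1%:R * a)); first by rewrite ler_wpM2r ?ltW // ltr_nat.
  by rewrite /a mulrC divfK ?gt_eqF // ge_min lexx.
have na2 : (n%:R + 1) * a <= r * (e / 4).
  by rewrite natr1 /a mulrC divfK ?gt_eqF // ge_min lexx orbT.
exists a => // x y xc yc xy; apply/forallP => i.
have m_xy := le_trans (mass_lipschitz xy) na1.
have cx := cone_ext_coord i xc; have cy := cone_ext_coord i yc.
have [xs|xb] := leP (mass x) (e / 4).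
  apply: le_trans (ler_normB _ _) _; move: m_xy; rewrite ler_norml => /andP[h1 h2]; lra.
have [ys|yb] := leP (mass y) (e / 4).
  apply: le_trans (ler_normB _ _) _; move: m_xy; rewrite ler_norml => /andP[h1 h2]; lra.
have mx0 : 0 < mass x by apply: lt_trans xb.
have my0 : 0 < mass y by apply: lt_trans yb.
have xR := cone_realization xc mx0; have yR := cone_realization yc my0.
set u := _ *: x in xR; set v := _ *: y in yR.
have uv : close r u v.
  apply/forallP => j; rewrite !mxE.
  have -> : (mass x)^-1 * x ord0 j - (mass y)^-1 * y ord0 j =
    (x ord0 j - y ord0 j + y ord0 j / mass y * (mass y - mass x)) / mass x.
    by field; rewrite !gt_eqF.
  rewrite normrM normfV (gtr0_norm mx0) ler_pdivrMr //.
  apply: (@le_trans _ _ (r * (e / 4))); last by rewrite ler_wpM2l // ltW.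
  apply: le_trans na2; rewrite mulrDl mul1r [leRHS]addrC.
  apply: le_trans (ler_normD _ _) _; apply: lerD; first by have /forallP := xy; apply.
  rewrite normrM -[leRHS]mul1r; apply: ler_pM => //; last first.
    by rewrite distrC; apply: mass_lipschitz.
  rewrite normrM normfV (gtr0_norm my0) ler_pdivrMr // mul1r; exact: coord_le_mass.
have /forallP/(_ i) fuv := fr _ _ xR yR uv.
rewrite !mxE -/u -/v.
have -> : mass x * f u ord0 i - mass y * f v ord0 i =
  mass x * (f u ord0 i - f v ord0 i) + (mass x - mass y) * f v ord0 i by ring.
apply: le_trans (ler_normD _ _) _; rewrite [e]splitr; apply: lerD.
  rewrite normrM gtr0_norm // -[leRHS]mul1r; apply: ler_pM => //; first exact: ltW.
  by have [] := xc.
rewrite normrM -[leRHS]mulr1; apply: ler_pM => //; first by move: m_xy e0; lra.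
by have [<- _] := fK yR; apply: l1norm_coord.
Qed.

(** [trunc e z] and [trunc e (- z)] approximate the positive and negative parts of [z]. For
    nonnegative [e] their supports are disjoint, so they give a point of the deleted join once both
    supports are faces. *)
Definition trunc (e : R) (z : 'rV[R]_n) : 'rV[R]_n :=
  \row_i (if e < z ord0 i then z ord0 i else 0).

(** The jump at the threshold has height [e], whence the doubled bound. *)
Lemma trunc_close e z1 z2 : 0 <= e -> close e z1 z2 ->
  close (e + e) (trunc e z1) (trunc e z2).
Proof.
move=> e0 /forallP zz; apply/forallP => i; rewrite !mxE; have := zz i.
rewrite !ler_norml => /andP[h1 h2].
by case: ltP => h3; case: ltP => h4; apply/andP; split; lra.
Qed.

Lemma trunc_ge0 e z i : 0 <= e -> 0 <= trunc e z ord0 i.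
Proof. by move=> e0; rewrite mxE; case: ifP => // /ltW; apply: le_trans. Qed.

Lemma trunc_gt e z i : trunc e z ord0 i != 0 -> e < z ord0 i.
Proof. by rewrite mxE; case: ifP => //; rewrite eqxx. Qed.

Lemma trunc_norm e z i : 0 <= e ->
  `|z ord0 i| - e <= trunc e z ord0 i + trunc e (- z) ord0 i <= `|z ord0 i|.
Proof.
move=> e0; rewrite !mxE; case: (lerP 0 (z ord0 i)) => z0.
  rewrite ger0_norm //; case: ltP => h1; case: ltP => h2; apply/andP; split; lra.
rewrite ltr0_norm //; case: ltP => h1; case: ltP => h2; apply/andP; split; lra.
Qed.

Lemma trunc_mass e z : 0 <= e ->
  l1norm z - n%:R * e <= mass (trunc e z) + mass (trunc e (- z)) <= l1norm z.
Proof.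
move=> e0; rewrite /mass /l1norm -big_split /=; apply/andP; split; last first.
  by apply: ler_sum => i _; have /andP[] := trunc_norm z i e0.
have -> : n%:R * e = \sum_(i < n) e by rewrite sumr_const card_ord mulr_natl.
by rewrite -sumrB; apply: ler_sum => i _; have /andP[] := trunc_norm z i e0.
Qed.

(* On the deleted join of [K], the map [(s x, t y) |-> s f(x) - t f(y)] cannot
   vanish: taking norms gives [s = t], hence [f x = f y] and [x = y], although
   [x] and [y] have disjoint supports. *)
Lemma cone_ext_diff_gt : exists2 w, 0 < w &
  forall x y, cone x -> cone y -> 2^-1 <= mass x + mass y ->
    (forall i, x ord0 i != 0 -> y ord0 i = 0) ->
    exists i, w < `|(cone_ext x - cone_ext y) ord0 i|.
Proof.
have n0 : (0 : R) < n.+1%:R by rewrite ltr0n.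
(* Normalized points this close with disjoint supports would have total mass at most
   [n / (2 * n.+1)], which is below 1. *)
have n20 : (0 : R) < (2 * n.+1%:R)^-1 by rewrite invr_gt0 mulr_gt0.
have [k k0 gk] := g_unif n20.
have d0 : (0 : R) < d.+1%:R by rewrite ltr0n.
(* If all coordinates of the difference are at most [w], the masses differ by at most 1/8 and so are
   both at least 1/8; dividing by the mass then leaves the images under [f] within [8 * d.+1 * w],
   at most [k]. *)
pose w := Num.min k 1 / (8 * d.+1%:R).
have w0 : 0 < w by rewrite divr_gt0 ?mulr_gt0 // lt_min k0 ltr01.
have dw : 8 * (d.+1%:R * w) = Num.min k 1.
  by rewrite /w mulrA mulrC divfK // gt_eqF // mulr_gt0.
have dw1 : 8 * (d.+1%:R * w) <= 1 by rewrite dw ge_min lexx orbT.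
have dwk : 8 * (d.+1%:R * w) <= k by rewrite dw ge_min lexx.
exists w => // x y xc yc sxy xy0.
have [/existsP[i wi]|/existsPn nw] :=
    boolP [exists i, w < `|(cone_ext x - cone_ext y) ord0 i|]; first by exists i.
exfalso; have {}nw i : `|(cone_ext x - cone_ext y) ord0 i| <= w by rewrite leNgt nw.
have ext_norm z : cone z -> l1norm (cone_ext z) = mass z.
  move=> zc; rewrite l1norm_homogeneous ?mass_ge0 //.
  have := mass_ge0 zc; rewrite le_eqVlt => /predU1P[<-|z0]; first by rewrite mul0r.
  by have [-> _] := fK (cone_realization zc z0); rewrite mulr1.
have ds : `|mass x - mass y| <= d%:R * w.
  rewrite -(ext_norm _ xc) -(ext_norm _ yc); apply: l1norm_lipschitz.
  by apply/forallP => i; have := nw i; rewrite !mxE.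
have ds' : d%:R * w + w = d.+1%:R * w by rewrite -natr1 mulrDl mul1r.
have mx8 : 8^-1 <= mass x by move: ds; rewrite ler_norml => /andP[h1 h2]; lra.
have my8 : 8^-1 <= mass y by move: ds; rewrite ler_norml => /andP[h1 h2]; lra.
have mx0 : 0 < mass x by apply: lt_le_trans mx8; rewrite invr_gt0.
have my0 : 0 < mass y by apply: lt_le_trans my8; rewrite invr_gt0.
have xR := cone_realization xc mx0; have yR := cone_realization yc my0.
have [u1 gu] := fK xR; have [v1 gv] := fK yR.
have := gk _ _ u1 v1; rewrite gu gv => /(_ _)/forallP xy.
have {}xy i : `|((mass x)^-1 *: x) ord0 i - ((mass y)^-1 *: y) ord0 i| <=
    (2 * n.+1%:R)^-1.
  apply: xy; apply/forallP => j.
  have := nw j; rewrite !mxE; set a := f _ ord0 j; set b := f _ ord0 j => ab.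
  have b1 : `|b| <= 1 by rewrite -v1 l1norm_coord.
  apply: le_trans dwk; rewrite -ler_pdivrMl //.
  apply: (@le_trans _ _ (mass x * `|a - b|)); first by rewrite ler_wpM2r.
  rewrite -[X in X * _](gtr0_norm mx0) -normrM -ds'.
  have -> : mass x * (a - b) = (mass y - mass x) * b + (mass x * a - mass y * b).
    by ring.
  apply: le_trans (ler_normD _ _) _; apply: lerD => //.
  by rewrite normrM -[leRHS]mulr1 ler_pM // distrC.
have [x0 _ _] := xc; have [_ x1 _] := xR.
have : (1 : R) <= n%:R * (2 * n.+1%:R)^-1.
  rewrite -[leLHS]x1 mulr_natl -[X in _ *+ X]card_ord -sumr_const; apply: ler_sum => i _.
  have := xy i; rewrite !mxE; have [->|xi] := eqVneq (x ord0 i) 0.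
    by rewrite mulr0 => _; rewrite ltW.
  by rewrite (xy0 _ xi) mulr0 subr0; apply: le_trans; apply: ler_norm.
rewrite ler_pdivlMr ?mulr_gt0 // mul1r -natr1.
have : (0 : R) <= n%:R by []; lra.
Qed.

End LowerBound.

(** * Missing faces, signed labels and the lower bound for colourings *)

Lemma nonface_min_nonface N (K : scomplex 'I_N.+1) (A : {set 'I_N.+1}) :
  A \notin faces K -> exists M : KG2 K (simplex N), val M \subset A.
Proof.
move=> AK; have : (A \in faces (simplex N)) && (A \notin faces K) by rewrite /= inE AK.
move=> /(@minset_exists _ (fun B => (B \in faces (simplex N)) && (B \notin faces K)))[M Mmin MA].
have hM : M \in min_nonface K (simplex N) by rewrite inE.
by exists (exist _ M hM).
Qed.

Lemma min_nonface_notin (T : finType) (K L : scomplex T) (M : KG2 K L) :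
  val M \notin faces K.
Proof. by case: M => M /=; rewrite inE => /minsetp /andP[]. Qed.

Definition label_code (k : nat) (b : bool) : nat := b + k.*2.

Lemma half_label_code k b : (label_code k b)./2 = k.
Proof. exact: half_bit_double. Qed.

Lemma odd_label_code k b : odd (label_code k b) = b.
Proof. by rewrite /label_code oddD oddb odd_double addbF. Qed.

Lemma label_codeN k b : label_code k (~~ b) = flip (label_code k b).
Proof.
by apply: half_odd_inj; rewrite ?half_flip ?odd_flip ?half_label_code ?odd_label_code.
Qed.

Lemma colorable_lower_bound (R : realType) (N d m : nat) (K : scomplex 'I_N.+1) :
  triangulates_sphere R d K -> colorable (KG2 K (simplex N)) m ->
  (N.+1 <= m + d)%N.
Proof.
move=> /triangulation_l1sphere[f [g [f_unif g_unif fK _]]].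
move=> /existsP[c /forallP c_proper].
have [w w0 Ww] := cone_ext_diff_gt g_unif fK.
have [h h0 extw] := cone_ext_unif f_unif fK w0.
have N0 : (0 : R) < N.+1%:R by rewrite ltr0n.
(* [e + e <= h] serves [trunc_close]; [N.+1 * e <= 1 / 2] leaves the two truncations a total mass of
   at least 1/2. *)
pose e := Num.min (h / 2) (2 * N.+1%:R)^-1.
have e0 : 0 < e by rewrite lt_min divr_gt0 //= invr_gt0 mulr_gt0.
have eh : e + e <= h.
  by have : e <= h / 2; [rewrite ge_min lexx | lra].
have Ne : N.+1%:R * e <= 2^-1.
  have : e <= (2 * N.+1%:R)^-1 by rewrite ge_min lexx orbT.
  by move/(ler_wpM2l (ltW N0)); rewrite invfM mulrCA mulfV ?mulr1 // gt_eqF.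
pose above (z : 'rV[R]_N.+1) (A : {set 'I_N.+1}) := [forall i in A, e < z ord0 i].
pose W (z : 'rV[R]_N.+1) := cone_ext f (trunc e z) - cone_ext f (trunc e (- z)).
(* A missing face above the threshold in [z] or [- z] gives its colour; otherwise a large coordinate
   of [W] gives one of [d] further labels. Both choices are made by conditions invariant under [z]
   to [- z], so only the sign changes; [labP] shows that the default [0] is not reached on the l1
   sphere. *)
pose lab (z : 'rV[R]_N.+1) : nat :=
  if [pick M : KG2 K (simplex N) | above z (val M) || above (- z) (val M)] is Some M
  then label_code (c M) (above z (val M))
  else if [pick i | w < `|W z ord0 i|] is Some i
  then label_code (m + i) (0 < W z ord0 i) else 0%N.
have aboveN (z : 'rV[R]_N.+1) M : above z (val M) -> ~~ above (- z) (val (M : KG2 K (simplex N))).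
  move=> /forallP zM; apply/negP => /forallP zM'.
  have /set0Pn[i iM] : val M != finset.set0.
    by apply: contraNneq (min_nonface_notin M) => ->; apply: set0_face.
  have := zM i; have := zM' i; rewrite iM /= mxE; lra.
have WN (z : 'rV[R]_N.+1) : W (- z) = - W z by rewrite /W opprK opprB.
have WE z i : W z ord0 i =
    cone_ext f (trunc e z) ord0 i - cone_ext f (trunc e (- z)) ord0 i.
  by rewrite /W [LHS]mxE [X in _ + X]mxE.
have trunc_cone (z : 'rV[R]_N.+1) : l1norm z = 1 -> (forall M : KG2 K (simplex N), ~~ above z (val M)) ->
    cone K (trunc e z).
  move=> z1 zM; split.
  - by move=> i; apply: trunc_ge0; apply: ltW.
  - have /andP[_] := trunc_mass z (ltW e0); rewrite z1; apply: le_trans.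
    by rewrite lerDl sumr_ge0 // => i _; apply: trunc_ge0; apply: ltW.
  - apply: contraT => /nonface_min_nonface[M Mz]; case/negP: (zM M).
    apply/forallP => i; apply/implyP => iM.
    by apply: trunc_gt; have := fintype.subsetP Mz _ iM; rewrite inE.
have labP (z : 'rV[R]_N.+1) : l1norm z = 1 ->
    (exists2 M : KG2 K (simplex N), lab z = label_code (c M) (above z (val M)) &
       above z (val M) || above (- z) (val M)) \/
    (exists2 i : 'I_d, lab z = label_code (m + i) (0 < W z ord0 i) &
       [/\ w < `|W z ord0 i|, cone K (trunc e z) & cone K (trunc e (- z))]).
  move=> z1; rewrite /lab; case: pickP => [M hM|no]; first by left; exists M.
  have zN1 : l1norm (- z) = 1.
    by rewrite -z1; apply: eq_bigr => i _; rewrite mxE normrN.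
  have zc : cone K (trunc e z).
    by apply: trunc_cone => // M; have /negbT := no M; rewrite negb_or => /andP[].
  have zNc : cone K (trunc e (- z)).
    by apply: trunc_cone => // M; have /negbT := no M; rewrite negb_or => /andP[].
  right; case: pickP => [i hi|no']; first by exists i.
  have [||i] := Ww _ _ zc zNc; last by rewrite -/(W z) no'.
    have /andP[] := trunc_mass z (ltW e0); rewrite z1; lra.
  move=> i /trunc_gt zi; rewrite !mxE ltNge.
  by rewrite (_ : - z ord0 i <= e) //; lra.
have lab_lt (z : 'rV[R]_N.+1) : l1norm z = 1 -> ((lab z)./2 < m + d)%N.
  by case/labP => [[M ->]|[i ->]] _; rewrite half_label_code ?ltn_add2l // ltn_addr.
have labN (z : 'rV[R]_N.+1) : l1norm z = 1 -> lab (- z) = flip (lab z).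
  move=> z1; rewrite /lab opprK.
  rewrite (eq_pick (Q := fun M => above z (val M) || above (- z) (val M))); last first.
    by move=> M; rewrite /= orbC.
  case: pickP => [M|no].
    rewrite -label_codeN => hM; congr label_code.
    have := aboveN z M; case: (above z _) hM => /= [_ /(_ isT)/negbTE //|-> //].
  rewrite (eq_pick (Q := fun i => w < `|W z ord0 i|)); last first.
    by move=> i; rewrite /= WN mxE normrN.
  case: pickP => [i wi|no'].
    rewrite -label_codeN WN mxE oppr_gt0; congr label_code; rewrite -leNgt lt_neqAle.
    by case: eqP wi => // ->; rewrite normr0 ltNge ltW.
  have [[M _ hM]|[i _ [hi _ _]]] := labP z z1; last by rewrite no' in hi.
  by rewrite no in hM.
have labC (x y : 'rV[R]_N.+1) : l1norm x = 1 -> l1norm y = 1 -> close e x y -> lab x != flip (lab y).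
  wlog ox : x y / odd (lab x).
    move=> wl x1 y1 xy; have [/wl->//|ox] := boolP (odd (lab x)).
    apply/eqP => E; have oy : odd (lab y) by move: ox; rewrite E odd_flip negbK.
    have := wl y x oy y1 x1; rewrite close_sym => /(_ xy)/eqP; apply.
    by apply: half_odd_inj; rewrite E ?half_flip ?odd_flip ?half_flip ?negbK.
  move=> x1 y1 xy; apply/eqP => E.
  have oy : ~~ odd (lab y) by move: ox; rewrite E odd_flip.
  have hxy : (lab x)./2 = (lab y)./2 by rewrite E half_flip.
  move: hxy ox oy; case: (labP x x1) => [[M -> hM]|[i -> [hi xc xNc]]];
    case: (labP y y1) => [[M' -> hM']|[j -> [hj yc yNc]]];
    rewrite !half_label_code !odd_label_code => hxy ox oy.
  (* Missing faces of the same colour meet, and a common vertex has coordinate above [e] in [x] and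
     below [- e] in [y]. *)
  - have {}oy : above (- y) (val M') by move: hM'; rewrite (negbTE oy).
    have : ~~ adj M M'.
      apply/negP => MM'; have /forallP/(_ M')/implyP/(_ MM')/eqP := c_proper M.
      by apply; apply: val_inj.
    rewrite /= /KG2_adj -setI_eq0 => /set0Pn[i]; rewrite inE => /andP[iM iM'].
    move/forallP/(_ i): ox; rewrite iM /= => xi.
    move/forallP/(_ i): oy; rewrite iM' /= mxE => yi.
    by move/forallP/(_ i): xy; rewrite ler_norml => /andP[h1 h2]; move: e0; lra.
  - by have := ltn_ord (c M); rewrite hxy ltnNge leq_addr.
  - by have := ltn_ord (c M'); rewrite -hxy ltnNge leq_addr.
  (* The coordinate of [W] is above [w] at [x] and below [- w] at [y], but each of its two terms
     varies by at most [w]. *)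
  - have ij : i = j by apply: val_inj; apply/eqP; rewrite -(eqn_add2l m); apply/eqP.
    subst j; have xyN : close e (- x) (- y).
      by apply/forallP => k; rewrite !mxE opprK addrC distrC; move/forallP: xy; apply.
    have c1 := close_le eh (trunc_close (ltW e0) xy).
    have c2 := close_le eh (trunc_close (ltW e0) xyN).
    have /forallP/(_ i) := extw _ _ xc yc c1.
    have /forallP/(_ i) := extw _ _ xNc yNc c2.
    move: hi hj ox oy; rewrite !WE -leNgt.
    move=> hi hj ox oy; rewrite !ler_norml => /andP[h1 h2] /andP[h3 h4].
    by move: hi hj; rewrite gtr0_norm // ler0_norm //; lra.
have [s [sn s1 _ us]] := hemisphere_fan e0 (fun x x1 _ => labN x x1)
  (fun x y x1 y1 _ _ xy => labC x y x1 y1 xy).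
rewrite -sn -(size_map lab) -(size_map half) -(size_iota 0 (m + d)).
apply: uniq_leq_size us _ => _ /mapP[_ /mapP[x xs ->] ->].
by rewrite mem_iota /= lab_lt //; have [] := s1 _ xs.
Qed.

(** * Upper bound *)

Lemma uniq_map_coarser (T U V : eqType) (q : T -> U) (r : T -> V) (s : seq T) :
  {in s &, forall x y, r x = r y -> q x = q y} -> uniq (map q s) -> uniq (map r s).
Proof.
elim: s => //= x s IH rq /andP[xs us]; apply/andP; split; last first.
  by apply: IH us => y z ys zs; apply: rq; rewrite inE ?ys ?zs orbT.
apply: contra xs => /mapP[y ys xy]; apply/mapP; exists y => //.
by apply: rq; rewrite ?inE ?eqxx ?ys ?orbT.
Qed.

(** * Rounding barycentric coordinates *)

Section Rounding.
Variables (R : realType) (n M : nat).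
Implicit Types (x y : 'rV[R]_n) (t : R).

Definition partial_sum k x : R := M%:R * \sum_(i < n | (i < k)%N) x ord0 i.

(* Rounding the partial sums rather than the coordinates keeps the total mass;
   as [t] varies, the values [rounding t x] are the vertices of the simplex
   containing [x] in the edgewise subdivision. *)
Definition rounding t x : 'rV[R]_n :=
  \row_i ((Num.floor (partial_sum i.+1 x + t) - Num.floor (partial_sum i x + t))%:~R
    / M%:R).

Lemma partial_sum0 x : partial_sum 0 x = 0.
Proof. by rewrite /partial_sum big_pred0_eq mulr0. Qed.

Lemma partial_sumS x (i : 'I_n) :
  partial_sum i.+1 x = partial_sum i x + M%:R * x ord0 i.
Proof.
rewrite /partial_sum -mulrDr (bigD1 i) //= addrC; congr (_ * (_ + _)).
by apply: eq_bigl => j; rewrite ltnS ltn_neqAle andbC.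
Qed.

Lemma partial_sum_full x : \sum_i x ord0 i = 1 -> partial_sum n x = M%:R.
Proof.
move=> x1; rewrite /partial_sum (eq_bigl xpredT) ?x1 ?mulr1 // => i.
by rewrite ltn_ord.
Qed.

Lemma partial_sum_close k x y h : 0 <= h -> close h x y ->
  `|partial_sum k x - partial_sum k y| <= M%:R * (n%:R * h).
Proof.
move=> h0 /forallP xy; rewrite /partial_sum -mulrBr normrM ger0_norm ?ler0n //.
rewrite ler_wpM2l ?ler0n // -sumrB; apply: le_trans (ler_norm_sum _ _ _) _.
have -> : n%:R * h = \sum_(i < n) h by rewrite sumr_const card_ord mulr_natl.
by rewrite big_mkcond; apply: ler_sum => i _; case: ifP.
Qed.

Definition gap : R := (2 * n.+2%:R)^-1.

Lemma gap_gt0 : 0 < gap.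
Proof. by rewrite invr_gt0 mulr_gt0 ?ltr0n. Qed.

Definition good_shift x t :=
  forall (j : 'I_n.+1) (z : int), gap <= `|partial_sum j x + t - z%:~R|.

(** Pigeonhole on the [n.+2] shifts [k / n.+2]: if all were bad, two would fail at the same one of
    the [n.+1] partial sums. They would then differ by less than [2 * gap = 1 / n.+2] modulo 1,
    which distinct shifts do not. *)
Lemma good_shift_exists x : exists t, [/\ 0 <= t, t < 1 & good_shift x t].
Proof.
have n0 : (0 : R) < n.+2%:R by rewrite ltr0n.
have gapE : 2 * gap * n.+2%:R = 1.
  by rewrite /gap; move: n0; move: (n.+2%:R) => a a0; field; rewrite gt_eqF.
apply: contrapT => none.
have bad (k : 'I_n.+2) : exists j : 'I_n.+1, exists z : int,
    `|partial_sum j x + k%:R / n.+2%:R - z%:~R| < gap.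
  apply: contrapT => nobad; apply: none; exists (k%:R / n.+2%:R); split.
  - by rewrite divr_ge0 // ler0n.
  - by rewrite ltr_pdivrMr // mul1r ltr_nat.
  - move=> j z; rewrite leNgt; apply/negP => jz; apply: nobad; by exists j, z.
have [j jP] := choice bad.
have /injectivePn[k [l kl jkl]] : ~~ injectiveb j.
  by apply/negP => /injectiveP /leq_card; rewrite !card_ord ltnn.
wlog {kl} kl : k l jkl / (k < l)%N.
  move=> wl; have [/(wl k l jkl)//|lk] := ltnP k l; apply: (wl l k) => //.
  by rewrite ltn_neqAle lk eq_sym kl.
have [z hz] := jP k; have [z' hz'] := jP l.
rewrite jkl in hz; move: hz hz'; rewrite !ltr_norml => /andP[h1 h2] /andP[h3 h4].
have kl1 : k%:R + 1 <= l%:R :> R by rewrite natr1 ler_nat.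
have ln1 : l%:R + 1 <= n.+2%:R :> R by rewrite natr1 ler_nat; apply: ltn_ord.
have k0 : 0 <= k%:R :> R by rewrite ler0n.
have g2 : 2 * gap <= l%:R / n.+2%:R - k%:R / n.+2%:R.
  by rewrite -mulrBl ler_pdivlMr // gapE lerBrDl.
have g3 : l%:R / n.+2%:R - k%:R / n.+2%:R <= 1 - 2 * gap.
  rewrite -mulrBl ler_pdivrMr // mulrBl gapE mul1r.
  by move: kl1 ln1 k0; move: (k%:R) (l%:R) (n.+2%:R) => a b c; lra.
move: h1 h2 h3 h4 g2 g3; move: (k%:R / _) (l%:R / _) gap => a b c h1 h2 h3 h4 g2 g3.
have : (z' - z)%:~R < 1%:~R :> R by rewrite intrB; lra.
have : (0 : int)%:~R < (z' - z)%:~R :> R by rewrite intrB; lra.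
by rewrite !ltr_int; lia.
Qed.

Lemma floor_close x y t (j : 'I_n.+1) : good_shift x t ->
  `|partial_sum j x - partial_sum j y| < gap ->
  Num.floor (partial_sum j y + t) = Num.floor (partial_sum j x + t).
Proof.
move=> gx xy; set u := partial_sum j x + t; set a := Num.floor u.
have /andP[ua ua1] : a%:~R <= u < (a + 1)%:~R := floor_itv u.
have := gx j a; have := gx j (a + 1); rewrite -/u => g1 g2.
apply: floor_def; move: ua ua1 g1 g2 xy; rewrite intrD => ua ua1.
rewrite ler0_norm; last by lra.
rewrite ger0_norm; last by lra.
by rewrite ltr_norml /u => g1 g2 /andP[h1 h2]; apply/andP; split; lra.
Qed.

Lemma rounding_close_eq x y t : good_shift x t ->
  (forall j : 'I_n.+1, `|partial_sum j x - partial_sum j y| < gap) ->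
  rounding t y = rounding t x.
Proof.
move=> gx xy; apply/rowP => i; rewrite !mxE.
have E (j : nat) (jn : (j < n.+1)%N) := floor_close gx (xy (Ordinal jn)).
by rewrite (E i (ltnW (ltn_ord i))) (E i.+1 (ltn_ord i)).
Qed.

Section Point.
Hypothesis M_gt0 : (0 < M)%N.
Variables (x : 'rV[R]_n).
Hypotheses (x0 : forall i, 0 <= x ord0 i) (x1 : \sum_i x ord0 i = 1).

Let M0 : (0 : R) < M%:R.
Proof. by rewrite ltr0n. Qed.

Lemma rounding_ge0 t i : 0 <= rounding t x ord0 i.
Proof.
rewrite mxE divr_ge0 ?ler0n // ler0z subr_ge0 le_floor // partial_sumS.
by rewrite lerD2r lerDl mulr_ge0.
Qed.

Lemma rounding_eq0 t i : x ord0 i = 0 -> rounding t x ord0 i = 0.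
Proof. by move=> xi; rewrite mxE partial_sumS xi mulr0 addr0 subrr mul0r. Qed.

Lemma floor_full t : 0 <= t -> t < 1 -> Num.floor (partial_sum n x + t) = M%:Z.
Proof.
move=> t0 t1; apply: floor_def; rewrite partial_sum_full // intrD.
by apply/andP; split; rewrite -pmulrn; lra.
Qed.

Lemma rounding_sum t : 0 <= t -> t < 1 -> \sum_i rounding t x ord0 i = 1.
Proof.
move=> t0 t1; under eq_bigr do rewrite mxE.
rewrite -mulr_suml -rmorph_sum /=.
rewrite -(big_mkord xpredT (fun i =>
  Num.floor (partial_sum i.+1 x + t) - Num.floor (partial_sum i x + t))).
rewrite telescope_sumr // floor_full // partial_sum0 add0r.
rewrite (@floor_def _ _ 0) ?t0 ?t1 // subr0.
by rewrite -pmulrn mulfV // gt_eqF.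
Qed.

Lemma rounding_close t : close M%:R^-1 x (rounding t x).
Proof.
apply/forallP => i; rewrite mxE -(ler_pM2l M0) mulfV ?gt_eqF //.
rewrite -{1}(gtr0_norm M0) -normrM mulrBr [_ * (_ / _)]mulrC divfK ?gt_eqF // intrB.
have /andP[h1 h2] := floor_itv (partial_sum i.+1 x + t).
have /andP[h3 h4] := floor_itv (partial_sum i x + t).
move: h2 h4; rewrite !intrD => h2 h4; have := partial_sumS x i => E.
by rewrite ler_norml; apply/andP; split; lra.
Qed.

(** The indices in the support at which adding [t] reaches the next integer. This set grows with
    [t], so its size alone determines it. *)
Definition carry t : {set 'I_n} :=
  [set i | (x ord0 i != 0) &&
    (Num.floor (partial_sum i x + t) != Num.floor (partial_sum i x))]%SET.

Lemma floor_shift j t : 0 <= t -> t < 1 ->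
  Num.floor (partial_sum j x) <= Num.floor (partial_sum j x + t) <=
  Num.floor (partial_sum j x) + 1.
Proof.
move=> t0 t1; rewrite le_floor ?lerDl //=.
have /andP[_ h] := floor_itv (partial_sum j x).
have -> : Num.floor (partial_sum j x) + 1 = Num.floor (partial_sum j x + 1).
  by rewrite floorDrz ?floor1.
by rewrite le_floor // lerD2l ltW.
Qed.

(** The first index of the support has partial sum zero and never carries, as [t < 1]. *)
Lemma card_carry t : 0 <= t -> t < 1 ->
  (#|carry t| < #|[set i | x ord0 i != 0%R]%SET|)%N.
Proof.
move=> t0 t1; have [i0 xi0] : exists i, x ord0 i != 0.
  apply/existsP; apply: contraT => /existsPn h.
  move: x1; rewrite big1 => [/eqP|i _]; first by rewrite eq_sym oner_eq0.
  by apply/eqP; have := h i; rewrite negbK.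
have [i xi imin] := @arg_minnP _ i0 (fun i => x ord0 i != 0) val xi0.
apply: proper_card; apply/properP; split.
  by apply/fintype.subsetP => j; rewrite !inE => /andP[].
exists i; rewrite !inE // xi /= negbK.
have -> : partial_sum i x = 0.
  rewrite /partial_sum big1 ?mulr0 // => j ji; apply/eqP; apply: contraTT ji => xj.
  by rewrite -leqNgt; apply: imin.
by rewrite add0r floor0 (@floor_def _ _ 0) // t0 t1.
Qed.

(** Nested carry sets of equal size coincide. Floors then agree by descending induction from the
    full sum: on the support the carry decides, elsewhere the next partial sum is the same. *)
Lemma carry_rounding t t' : 0 <= t -> t < 1 -> 0 <= t' -> t' < 1 ->
  #|carry t| = #|carry t'| -> rounding t x = rounding t' x.
Proof.
wlog tt' : t t' / t <= t'.
  move=> wl t0 t1 t'0 t'1 E; have [/wl->//|/ltW/wl E'] := leP t t'.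
  by apply/esym; apply: E'.
move=> t0 t1 t'0 t'1 E.
have sub : carry t \subset carry t'.
  apply/fintype.subsetP => i; rewrite !inE => /andP[-> h] /=.
  have /andP[h1 h2] := floor_shift i t0 t1; have /andP[h3 h4] := floor_shift i t'0 t'1.
  have h5 : Num.floor (partial_sum i x + t) <= Num.floor (partial_sum i x + t').
    by rewrite le_floor // lerD2l.
  by apply: contra h => /eqP h; rewrite eq_le h1 andbT -h.
have {sub} E' : carry t = carry t'.
  by apply/eqP; rewrite eqEcard sub E leqnn.
have fl k : (k <= n)%N ->
    Num.floor (partial_sum k x + t) = Num.floor (partial_sum k x + t').
  move=> /subnK; move: (n - k)%N => m; elim: m k => [|m IH] k kn.
    by rewrite add0n in kn; rewrite kn !floor_full.
  have kn' : (k < n)%N by rewrite -kn addSn ltnS leq_addl.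
  have [xk|xk] := eqVneq (x ord0 (Ordinal kn')) 0.
    have := IH k.+1; rewrite addnS -addSn => /(_ kn).
    by rewrite (partial_sumS x (Ordinal kn')) xk mulr0 addr0.
  have : (Ordinal kn' \in carry t) = (Ordinal kn' \in carry t') by rewrite E'.
  rewrite !inE xk /=.
  have /andP[h1 h2] := floor_shift k t0 t1; have /andP[h3 h4] := floor_shift k t'0 t'1.
  by case: eqP => [->|a]; case: eqP => [->|b] // _; lia.
by apply/rowP => i; rewrite !mxE !fl // ltnW.
Qed.

End Point.
End Rounding.

(** Each point is rounded with its own good shift. On a set of small diameter these values are all
    roundings of one point [x], classified by carry counts smaller than the size of the support of
    [x]. *)
Lemma realization_rounding (R : realType) (n k : nat) (K : scomplex 'I_n) :
  (forall F, F \in faces K -> (#|F| <= k)%N) -> forall e : R, 0 < e ->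
  exists q : 'rV[R]_n -> 'rV[R]_n, exists2 h, 0 < h &
    (forall x, realization K x -> realization K (q x) /\ close e x (q x)) /\
    (forall s, {in s, forall x, realization K x} -> diam_le h s ->
      uniq (map q s) -> (size s <= k)%N).
Proof.
move=> Kk e e0.
pose M := (Num.Def.archi_bound e^-1).+1; have M0 : (0 < M)%N by [].
have MR0 : (0 : R) < M%:R by rewrite ltr0n.
have Me : (M%:R)^-1 <= e.
  rewrite -[leRHS]invrK lef_pV2 ?posrE ?invr_gt0 //; apply: ltW.
  apply: lt_trans (archi_boundP _) _; first by rewrite invr_ge0 ltW.
  by rewrite ltr_nat.
have [t /all_and3[t0 t1 tP]] := choice (@good_shift_exists R n M).
have hP : 0 < gap R n / (M%:R * n.+1%:R) by rewrite divr_gt0 ?gap_gt0 // mulr_gt0 // ltr0n.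
exists (fun x => rounding M (t x) x), (gap R n / (M%:R * n.+1%:R)) => //; split.
  move=> x [x0 x1 xK]; split.
    split.
    - by move=> i; apply: rounding_ge0.
    - exact: rounding_sum.
    - apply: (@sub_face _ K _ _ _ xK); apply/fintype.subsetP => i; rewrite !inE.
      by apply: contraNneq => xi; rewrite rounding_eq0.
  exact: close_le Me (rounding_close M0 x (t x)).
case=> [//|x s] sK /allrelP sh us.
have [x0 x1 xK] := sK x (mem_head x s).
(* The shift [t y] is good at [y], so the floors do not change on passing from [y] to [x]. *)
have qE : {in x :: s, forall y, rounding M (t y) y = rounding M (t y) x}.
  move=> y ys; apply/esym/rounding_close_eq => // j.
  apply: le_lt_trans (partial_sum_close _ _ (ltW hP) (sh _ _ ys (mem_head x s))) _.
  have -> : M%:R * (n%:R * (gap R n / (M%:R * n.+1%:R))) = gap R n * (n%:R / n.+1%:R).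
    have := ltr0Sn R n; move: (n.+1%:R : R) (n%:R : R) (gap R n) => a b c a0.
    by field; rewrite !gt_eqF.
  by rewrite -[ltRHS]mulr1 ltr_pM2l ?gap_gt0 // ltr_pdivrMr ?ltr0Sn // mul1r ltr_nat.
have uc : uniq (map (fun y => #|carry M x (t y)|) (x :: s)).
  apply: uniq_map_coarser us => y z ys zs E.
  by rewrite (qE y) // (qE z) //; apply: carry_rounding.
rewrite -(size_map (fun y => #|carry M x (t y)|)) -[leqRHS](size_iota 0).
apply: uniq_leq_size uc _ => _ /mapP[y _ ->]; rewrite mem_iota /=.
by apply: leq_trans (Kk _ xK); apply: card_carry.
Qed.

Lemma large_face (R : realType) (n d : nat) (K : scomplex 'I_n) :
  triangulates_sphere R d K -> exists2 F, F \in faces K & (d <= #|F|)%N.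
Proof.
case: d => [_|k]; first by exists finset.set0; rewrite ?set0_face.
move=> /triangulation_l1sphere[f [g [f_unif g_unif fK gK]]].
apply: contrapT => noface.
have Kk F : F \in faces K -> (#|F| <= k)%N.
  by move=> FK; rewrite leqNgt; apply/negP => kF; apply: noface; exists F.
(* With [k.+1 * r = 1 / 2], a point of the equator has a coordinate above [r], and a point whose
   first [k] coordinates are at most [r + r / 2] has its last one above [e]. *)
pose r : R := (2 * k.+1%:R)^-1.
have k0 : (0 : R) <= k%:R by rewrite ler0n.
have r0 : 0 < r by rewrite invr_gt0 mulr_gt0 ?ltr0n.
have kr : k%:R * r + r = 2^-1.
  by rewrite /r -(natr1 k); move: k0; move: (k%:R) => a a0; field; rewrite gt_eqF //; lra.
have r2 : 0 < r / 2 by rewrite divr_gt0.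
have [p p0 fp] := f_unif _ r2.
have [q [h h0 [qK q_card]]] := realization_rounding Kk p0.
have [a a0 ga] := g_unif _ h0.
pose e := Num.min a (r / 2).
have e0 : 0 < e by rewrite lt_min a0.
have er : e <= r / 2 by rewrite ge_min lexx orbT.
pose w (i : 'I_k) : 'I_k.+1 := widen_ord (leqnSn k) i.
have l1E (x : 'rV[R]_k.+1) : l1norm x = \sum_i `|x ord0 (w i)| + `|x ord0 ord_max|.
  by rewrite /l1norm big_ord_recr.
(* The default label [k] carries one sign only, so its opposite never occurs; [labN] relies on the
   default not arising on the equator. *)
pose L (y : 'rV[R]_k.+1) : nat :=
  if [pick i | r < `|y ord0 (w i)|] is Some i
  then label_code i (0 < y ord0 (w i)) else label_code k false.
have LP y : (exists2 i : 'I_k, L y = label_code i (0 < y ord0 (w i)) & r < `|y ord0 (w i)|) \/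
    (L y = label_code k false /\ forall i, `|y ord0 (w i)| <= r).
  rewrite /L; case: pickP => [i hi|no]; first by left; exists i.
  by right; split => // i; rewrite leNgt no.
pose th x := f (q (g x)).
have thP x : l1norm x = 1 -> close (r / 2) x (th x).
  move=> x1; have [gx fgx] := gK _ x1; have [qx gq] := qK _ gx.
  by rewrite -{1}fgx; apply: fp.
pose near_pole (x : 'rV[R]_k.+1) := if x ord0 ord_max == 0 then x else th x.
pose lab x := L (near_pole x).
have np x : l1norm x = 1 -> close (r / 2) x (near_pole x).
  by rewrite /near_pole; case: eqP => [_ _|_ /thP //]; apply: close_refl; apply: ltW.
have small_sum (x : 'rV[R]_k.+1) b : l1norm x = 1 -> (forall i, `|x ord0 (w i)| <= b) ->
    1 - k%:R * b <= `|x ord0 ord_max|.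
  move=> x1 xb; rewrite -[X in X - _]x1 l1E lerBlDr addrC lerD2l.
  have -> : k%:R * b = \sum_(i < k) b by rewrite sumr_const card_ord mulr_natl.
  by apply: ler_sum => i _; apply: xb.
(* On the equator the labels are antipodal; elsewhere they depend only on the
   moved point [th x]. *)
have labN x : l1norm x = 1 -> x ord0 ord_max = 0 -> lab (- x) = flip (lab x).
  move=> x1 xm; rewrite /lab /near_pole mxE oppr_eq0 xm eqxx.
  have := LP x; rewrite /L (eq_pick (Q := fun i => r < `|x ord0 (w i)|)); last first.
    by move=> i; rewrite /= mxE normrN.
  case: pickP => [i hi _|no].
    rewrite -label_codeN mxE oppr_gt0; congr label_code; rewrite -leNgt lt_neqAle.
    by case: eqP hi => // ->; rewrite normr0 ltNge ltW.
  case=> [[i _]|[_ xr]]; first by rewrite no.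
  by exfalso; have := small_sum x r x1 xr; rewrite xm normr0; lra.
have labC x y : l1norm x = 1 -> l1norm y = 1 -> close e x y -> lab x != flip (lab y).
  move=> x1 y1 xy; apply/eqP => E.
  have ho : (lab x)./2 = (lab y)./2 by rewrite E half_flip.
  have oo : odd (lab x) = ~~ odd (lab y) by rewrite E odd_flip.
  move: ho oo; rewrite /lab; case: (LP (near_pole x)) => [[i -> hi]|[-> hx]];
    case: (LP (near_pole y)) => [[j -> hj]|[-> hy]];
    rewrite !half_label_code !odd_label_code // => ij.
  (* Opposite signs put the two coordinates more than [2 * r] apart, while two moves of [r / 2] and
     [e <= r / 2] allow only [3 * r / 2]. *)
  - have {}ij : j = i by apply/val_inj.
    subst j; have /forallP/(_ (w i)) := np _ x1; have /forallP/(_ (w i)) := np _ y1.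
    have /forallP/(_ (w i)) := xy; move: hi hj.
    move: (near_pole x ord0 _) (near_pole y ord0 _) (x ord0 _) (y ord0 _) => x' y' u v.
    rewrite !ler_norml => hi hj /andP[h1 h2] /andP[h3 h4] /andP[h5 h6] /esym.
    have [xp|xn] := ltP 0 x' => [|/negbFE yp].
      rewrite -leNgt => yn; move: hi hj; rewrite gtr0_norm // ler0_norm //; lra.
    by move: hi hj; rewrite ler0_norm // gtr0_norm //; lra.
  - by have := ltn_ord i; rewrite ij ltnn.
  - by have := ltn_ord j; rewrite -ij ltnn.
have [s [sk s1 sD us]] := hemisphere_fan e0 labN (fun x y x1 y1 _ _ => labC x y x1 y1).
have half_le x : ((lab x)./2 <= k)%N.
  by rewrite /lab; case: (LP (near_pole x)) => [[i ->]|[->]] _;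
    rewrite half_label_code // ltnW.
(* The [k.+1] distinct halves are at most [k], so one vertex has the default label. It lies far from
   the equator, and with it the whole small simplex, where labels factor through [q]. *)
have [x xs xk] : exists2 x, x \in s & (lab x)./2 = k.
  apply: contrapT => none.
  suff : (size (map half (map lab s)) <= k)%N by rewrite !size_map sk ltnn.
  rewrite -[leqRHS](size_iota 0); apply: uniq_leq_size us _ => _ /mapP[_ /mapP[x xs ->] ->].
  rewrite mem_iota /= ltn_neqAle half_le andbT; apply/eqP => xk.
  by apply: none; exists x.
have [x1 x0] := s1 _ xs.
have x_max : e < x ord0 ord_max.
  rewrite -(ger0_norm x0); apply: (@lt_le_trans _ _ (1 - k%:R * (r + r / 2))).
    by rewrite mulrDr mulrA; lra.
  apply: small_sum => // i.
  move: xk; rewrite /lab; case: (LP (near_pole x)) => [[j -> _]|[_ xr _]].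
    by rewrite half_label_code => jk; have := ltn_ord j; rewrite jk ltnn.
  have /forallP/(_ (w i)) := np _ x1; have := xr i.
  move: (near_pole x ord0 _) (x ord0 _) => u v.
  by rewrite !ler_norml => /andP[h1 h2] /andP[h3 h4]; apply/andP; split; lra.
have labE y : y \in s -> lab y = L (th y).
  move=> ys; rewrite /lab /near_pole gt_eqF //.
  move/allrelP: sD => /(_ _ _ xs ys)/forallP/(_ ord_max).
  by rewrite ler_norml => /andP[h1 h2]; lra.
(* Distinct labels force distinct values of [q] at [k.+1] close points of the realization, one more
   than the rounding admits. *)
suff : (size (map g s) <= k)%N by rewrite size_map sk ltnn.
apply: q_card => [_ /mapP[y ys ->]||].
- by have [/gK[]] := s1 _ ys.
- apply/allrelP => _ _ /mapP[y ys ->] /mapP[z zs ->]; apply: ga.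
  + by have [] := s1 _ ys.
  + by have [] := s1 _ zs.
  + by apply: (@close_le _ _ e); rewrite ?ge_min ?lexx //; move/allrelP: sD; apply.
- rewrite -map_comp; move: us; rewrite -map_comp; apply: uniq_map_coarser.
  by move=> y z ys zs /= E; rewrite !labE // /th E.
Qed.

(** Colouring a missing face by one of its vertices outside [F] is proper, since disjoint faces
    share no vertex. *)
Lemma colorable_card_setC (N : nat) (K : scomplex 'I_N.+1) (F : {set 'I_N.+1}) :
  F \in faces K -> colorable (KG2 K (simplex N)) #|~: F|.
Proof.
move=> FK; have /choice[v vP] : forall M : KG2 K (simplex N),
    exists u : {i | i \in ~: F}, val u \in val M.
  move=> M; have /subsetPn[i iM iF] : ~~ (val M \subset F).
    by apply: contra (min_nonface_notin M) => MF; apply: (@sub_face _ K _ _ MF FK).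
  have iC : i \in ~: F by rewrite inE.
  by exists (exist _ i iC).
have <- : #|{: {i | i \in ~: F}}| = #|~: F| by rewrite card_sig; apply: eq_card => i.
apply/existsP; exists [ffun M => enum_rank (v M)].
apply/forallP => M; apply/forallP => M'; apply/implyP => MM'.
rewrite !ffunE; apply/negP => /eqP/enum_rank_inj vMM'.
move: MM'; rewrite /= /KG2_adj -setI_eq0 => /eqP/setP/(_ (val (v M))).
by rewrite !inE vP vMM' vP.
Qed.

Theorem theorem5p3 (R : realType) (N d : nat) (K : scomplex 'I_N.+1)
    (K_vertices : spanning K) (K_sphere : triangulates_sphere R d K) :
  (chromatic_number (KG2 K (simplex N)))%:Z = N%:Z + 1 - d%:Z.
Proof.
rewrite /chromatic_number; case: ex_minnP => m mc m_min.
have lower := colorable_lower_bound K_sphere mc.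
have [F FK dF] := large_face K_sphere.
have := m_min _ (colorable_card_setC FK).
have := cardsC F; rewrite card_ord; lia.
Qed.
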